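(* There is a randomized algorithm that, given query access to an undirected graph $G=(V,E)$ on $n$ vertices with non-negative edge weights only through cut queries, computes the minimum cut (value) of $G$ with high probability using $\tilde O(n)$ cut queries.
   Context: A cut query takes a vertex set $S\subseteq V$ and returns the total weight of edges with exactly one endpoint in $S$. A minimum cut is a cut $(S,V\setminus S)$, $\emptyset\neq S\subsetneq V$, of minimum weight. $\tilde O(\cdot)$ hides polylogarithmic factors in $n$. ''With high probability'' means with probability at least $1-1/n^c$ for an arbitrarily large constant $c$. *)

(* Defs.v *)
From mathcomp Require Import all_boot all_order all_algebra.
From mathcomp Require Import reals interval_inference exp.

Set Implicit Arguments.
Unset Strict Implicit.
Unset Printing Implicit Defensive.
Import Order.TTheory GRing.Theory Num.Theory.
Local Open Scope ring_scope.

(* The weight function is only meaningful on [edges]; since nothing else reads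
   it, its values elsewhere are irrelevant. *)
Record wgraph (R : realType) (V : finType) := WGraph {
  edges : {set {set V}};
  weight : {set V} -> R;
  edges_card2 : forall e, e \in edges -> #|e| = 2%N;
  weight_ge0 : forall e, e \in edges -> 0 <= weight e
}.

Definition cut (R : realType) (V : finType) (G : wgraph R V) (S : {set V}) : R :=
  \sum_(e in edges G | #|e :&: S| == 1%N) weight G e.

Definition proper_cut (V : finType) (S : {set V}) : bool :=
  (S != set0) && (S \proper [set: V]).

Definition is_mincut (R : realType) (V : finType) (G : wgraph R V)
    (S : {set V}) : bool :=
  proper_cut S && [forall T : {set V}, proper_cut T ==> (cut G S <= cut G T)].

(* Randomized adaptive query algorithms with outputs in A, as decision trees:
   [Query X k] asks for the value of the oracle at X and continues with k
   applied to the answer; [Flip p a b] continues with a with probability p and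
   with b with probability 1 - p, independently of all other coins.  Internal
   computation is free: the only resource is the number of queries. *)
Inductive qalg (R : realType) (V : finType) (A : Type) : Type :=
| Ret of A
| Query of {set V} & (R -> qalg R V A)
| Flip of {i01 R} & qalg R V A & qalg R V A.

(* Probability that the run against the oracle f returns an output in P. *)
Fixpoint prob_out (R : realType) (V : finType) (A : Type)
    (f : {set V} -> R) (P : pred A) (a : qalg R V A) : R :=
  match a with
  | Ret x => (P x)%:R
  | Query X k => prob_out f P (k (f X))
  | Flip p a1 a2 =>
      p%:num * prob_out f P a1 + (1 - p%:num) * prob_out f P a2
  end.

(* Worst case, over all coin outcomes, of the number of queries made in the run
   against the oracle f. *)
Fixpoint num_queries (R : realType) (V : finType) (A : Type)
    (f : {set V} -> R) (a : qalg R V A) : nat :=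
  match a with
  | Ret _ => 0%N
  | Query X k => (num_queries f (k (f X))).+1
  | Flip _ a1 a2 => maxn (num_queries f a1) (num_queries f a2)
  end.

(* The output is a vertex set together with a number, which must be a minimum
   cut and its weight. *)
Definition correct_output (R : realType) (V : finType) (G : wgraph R V) :
    pred ({set V} * R) :=
  fun o => is_mincut G o.1 && (o.2 == cut G o.1).

(* Main.v *)
(* A random contraction (Karger) preserves a fixed minimum cut S0 with constant probability
   while reducing the total weight to O(n c), c a guess of the minimum cut; O(n log n) sampled
   edges of the contracted graph then form a known graph H in which all cuts weigh at least
   16/17, and S0 at most 18/17, of the expected sampled weight of S0. The guesses come from
   a deterministic Prim-like exploration, which is accurate up to a factor 2n.

   For any nonnegative weighting of the cuts some spanning tree is crossed, on average, at
   most (2 / mincut) * weight times (minimum spanning tree for the induced pair costs). This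
   gives both the union bound over all cuts, via the generating function of the tree-edge
   patterns, and O(log n) trees such that every near-minimum cut of H crosses one of them at
   most twice. Such a cut is a subtree, or a union X :|: Y of disjoint sets, each a subtree or
   the complement of one, and H shows that at least a third of the cut of X and of Y runs
   between them. Grouping subtrees of similar size into chains, the surviving pairs fall into
   blocks of total size O(n polylog n) on which the cut function is a Monge matrix, so that
   its minimum is found by divide and conquer with exact queries. *)
From mathcomp Require Import all_boot all_order all_algebra.
From mathcomp Require Import boolp reals interval_inference sequences exp.
From mathcomp Require Import zify ring lra.
Require Import Defs.

Set Implicit Arguments.
Unset Strict Implicit.
Unset Printing Implicit Defensive.
Import Order.TTheory GRing.Theory Num.Theory.
Local Open Scope ring_scope.

(** * Cuts of weight functions *)

(** Trying all pairs of subtrees would take quadratically many queries. [H] serves only to decide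
    which pairs are worth querying: it must leave no cut too light and [S0] not too heavy. All
    values compared in the end are exact answers, so a misleading [H] can cause a miss but never a
    wrong value, and repetition just keeps the best cut seen.

    Contraction has to precede sampling: the total weight may exceed [n * c] by any factor, and a
    sampled edge would then hardly ever cross [S0].

    The upper bound in [H] concerns [S0] alone and is left to Markov's inequality, hence the small
    success probability of one trial; only the lower bounds, for all cuts at once, use Chernoff. The
    ratio of 18/17 to 16/17 is 9/8. It keeps the average number of crossed tree edges at 9/4, below
    3, so some tree is crossed at most twice by a quarter of the near-minimum cuts. It also puts
    strictly more than a third of the cut of [X] and of [Y] between them, so a set cannot have three
    pairwise disjoint partners. This bound on partners is what keeps the total block size
    near-linear. *)

Section Between.
Variables (R : realType) (V : finType).
Implicit Types (w : V -> V -> R) (A B X Y S : {set V}).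

Lemma big_setU_disjoint (F : V -> R) A B : [disjoint A & B] ->
  \sum_(x in A :|: B) F x = \sum_(x in A) F x + \sum_(x in B) F x.
Proof. by move=> dAB; rewrite -bigU //; apply: eq_bigl => x; rewrite !inE. Qed.

Definition between w A B : R := \sum_(a in A) \sum_(b in B) w a b.

Definition wcut w S : R := between w S (~: S).

Definition nonneg_symmetric w :=
  (forall a b, w a b = w b a) /\ (forall a b, 0 <= w a b).

Lemma between_ge0 w A B : nonneg_symmetric w -> 0 <= between w A B.
Proof. by case=> _ w0; apply: sumr_ge0 => a _; apply: sumr_ge0. Qed.

Lemma betweenC w A B : nonneg_symmetric w -> between w A B = between w B A.
Proof.
case=> ws _; rewrite /between exchange_big /=.
by apply: eq_bigr => b _; apply: eq_bigr => a _.
Qed.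

Lemma between0l w B : between w set0 B = 0.
Proof. by rewrite /between big_set0. Qed.

Lemma between0r w A : between w A set0 = 0.
Proof. by rewrite /between big1 // => a _; rewrite big_set0. Qed.

Lemma between1r w A b : between w A [set b] = \sum_(a in A) w a b.
Proof. by apply: eq_bigr => a _; rewrite big_set1. Qed.

Lemma betweenUl w A A' B :
  [disjoint A & A'] -> between w (A :|: A') B = between w A B + between w A' B.
Proof. by move=> dA; rewrite /between big_setU_disjoint. Qed.

Lemma betweenUr w A B B' :
  [disjoint B & B'] -> between w A (B :|: B') = between w A B + between w A B'.
Proof.
move=> dB; rewrite /between -big_split /=.
by apply: eq_bigr => a _; rewrite big_setU_disjoint.
Qed.

Lemma between_sum1r w A B : between w A B = \sum_(b in B) between w A [set b].
Proof.
by rewrite /between exchange_big /=; apply: eq_bigr => b _; rewrite -between1r.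
Qed.

Lemma between_le w A A' B B' : nonneg_symmetric w ->
  A \subset A' -> B \subset B' -> between w A B <= between w A' B'.
Proof.
move=> wok /setIidPr sA /setIidPr sB.
have dD (Y Z : {set V}) : [disjoint Y :&: Z & Y :\: Z].
  by rewrite -setI_eq0; apply/eqP/setP=> x; rewrite !inE; do !case: (_ \in _).
rewrite -[in leRHS](setID A' A) betweenUl ?dD // sA.
rewrite -[in leRHS](setID B' B) !betweenUr ?dD // sB.
by rewrite -!addrA lerDl !addr_ge0 // between_ge0.
Qed.

Lemma wcut0 w : wcut w set0 = 0.
Proof. exact: between0l. Qed.

Lemma wcutT w : wcut w setT = 0.
Proof. by rewrite /wcut setCT between0r. Qed.

Lemma wcutC w S : nonneg_symmetric w -> wcut w (~: S) = wcut w S.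
Proof. by move=> wok; rewrite /wcut setCK betweenC. Qed.

Lemma wcutU w X Y : nonneg_symmetric w -> [disjoint X & Y] ->
  wcut w (X :|: Y) = wcut w X + wcut w Y - between w X Y *+ 2.
Proof.
move=> wok dXY; rewrite /wcut betweenUl //.
have [Z [-> -> -> dYZ dXZ]] : exists Z, [/\ ~: (X :|: Y) = Z, ~: X = Y :|: Z,
    ~: Y = X :|: Z, [disjoint Y & Z] & [disjoint X & Z]].
  exists (~: (X :|: Y)); have {}dXY : X :&: Y = set0 by apply/eqP; rewrite setI_eq0.
  move/setP: dXY => dXY.
  by split; rewrite -?setI_eq0 //; [| | apply/eqP | apply/eqP];
    apply/setP=> x; move: (dXY x); rewrite !inE; do !case: (_ \in _).
rewrite !betweenUr //.
rewrite (betweenC Y X wok); ring.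
Qed.

Lemma between_wcut_le w X Y : nonneg_symmetric w -> [disjoint X & Y] ->
  between w X Y <= wcut w X.
Proof.
by move=> wok dXY; apply: between_le; rewrite // -disjoints_subset disjoint_sym.
Qed.

(** Ordered pairs meet each separated pair twice; this is the source of the factor 2 in the
    averaging and sampling bounds. *)
Lemma sum_sep_wcut w S : nonneg_symmetric w ->
  \sum_a \sum_b w a b * ((a \in S) != (b \in S))%:R = wcut w S *+ 2.
Proof.
move=> wok; rewrite mulr2n -{2}(wcutC S wok) /wcut /between setCK.
rewrite (bigID (mem S)) /=; congr (_ + _).
  apply: eq_bigr => a aS; rewrite [RHS]big_mkcond; apply: eq_bigr => b _.
  by rewrite aS inE; case: (b \in S) => /=; rewrite ?mulr0 ?mulr1.
under [RHS]eq_bigl => a do rewrite inE.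
apply: eq_bigr => a aS; rewrite [RHS]big_mkcond; apply: eq_bigr => b _.
by rewrite (negPf aS); case: (b \in S) => /=; rewrite ?mulr0 ?mulr1.
Qed.

Lemma proper_cutE (S : {set V}) : proper_cut S = (S != set0) && (S != setT).
Proof. by rewrite /proper_cut properT. Qed.

Lemma proper_cutC (S : {set V}) : proper_cut (~: S) = proper_cut S.
Proof.
rewrite !proper_cutE andbC -(inj_eq (inv_inj (@setCK V))) setCK setCT.
by rewrite -[S == setT](inj_eq (inv_inj (@setCK V))) setCT.
Qed.

Lemma proper_cut1 (r : V) : (1 < #|V|)%N -> proper_cut [set r].
Proof.
move=> V1; rewrite proper_cutE -card_gt0 cards1 /=.
by apply: contraTneq V1 => E; rewrite -cardsT -E cards1.
Qed.

End Between.

(** * Rooted spanning trees *)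

Section RootedTree.
Variables (V : finType) (r : V).

(** [height] is any measure that drops along [parent], not necessarily the depth; it keeps the
    pointers acyclic. The tree lives on [V] alone and may use pairs of weight 0. *)
Record rooted_tree := RootedTree {
  parent : V -> V;
  height : V -> nat;
  parent_root : parent r = r;
  height_parent : forall v, v != r -> (height (parent v) < height v)%N }.

Variable T : rooted_tree.
Local Notation p := (parent T).
Implicit Types (S : {set V}) (u v x : V).

Definition subtree (v : V) : {set V} := [set x | fconnect p x v].

(** A tree edge is named by its lower end, so these are the tree edges crossed by [S]. *)
Definition flips (S : {set V}) : {set V} :=
  [set v | (v != r) && ((v \in S) != (p v \in S))].

Lemma subtree_refl v : v \in subtree v.
Proof. by rewrite inE connect0. Qed.

Lemma height_iter k v : (height T (iter k p v) <= height T v)%N.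
Proof.
elim: k v => [|k IH] v //=; have [E|vr] := eqVneq (iter k p v) r.
  by rewrite E parent_root -E.
by rewrite (leq_trans (ltnW (height_parent T vr))).
Qed.

Lemma iter_parent_root k : iter k p r = r.
Proof. by elim: k => //= k ->; rewrite parent_root. Qed.

Lemma fconnect_height x v : x != r -> x != v -> fconnect p x v ->
  (height T v < height T x)%N.
Proof.
move=> xr xv /iter_findex E; case: (findex _ _ _) E => [|k]; first by move/eqP: xv.
rewrite iterSr => <-; apply: leq_ltn_trans (height_iter _ _) _.
exact: height_parent T _ _.
Qed.

Lemma subtree_root v : v != r -> r \notin subtree v.
Proof.
move=> vr; rewrite inE; apply/negP=> /iter_findex E.
by move: vr; rewrite -E iter_parent_root eqxx.
Qed.

Lemma subtree_sub x v : x \in subtree v -> subtree x \subset subtree v.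
Proof.
by rewrite inE => xv; apply/subsetP => y; rewrite !inE => yx; apply: connect_trans xv.
Qed.

Lemma subtree_laminar u v : ~~ [disjoint subtree u & subtree v] ->
  (subtree u \subset subtree v) || (subtree v \subset subtree u).
Proof.
rewrite -setI_eq0 => /set0Pn[x]; rewrite !inE => /andP[/iter_findex eu /iter_findex ev].
set i := findex _ _ _ in eu; set j := findex _ _ _ in ev.
have [ij|/ltnW ji] := leqP i j; apply/orP; [left|right]; apply: subtree_sub; rewrite inE.
  by rewrite -eu -ev -(subnK ij) iterD fconnect_iter.
by rewrite -eu -ev -(subnK ji) iterD fconnect_iter.
Qed.

Lemma subtree_inj u v : u != r -> subtree u = subtree v -> u = v.
Proof.
move=> ur E; apply/eqP; apply: contraT => uv.
have vr : v != r.
  apply: contraTneq (subtree_refl u) => vr; rewrite E vr.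
  have: r \notin subtree u by apply: subtree_root.
  by rewrite E vr subtree_refl.
have [cuv cvu] : fconnect p u v /\ fconnect p v u.
  by have := subtree_refl v; have := subtree_refl u; rewrite {1}E -{2}E !inE.
have := fconnect_height ur uv cuv; rewrite ltnNge ltnW //.
by apply: fconnect_height => //; rewrite eq_sym.
Qed.

Lemma subtree_parent x v : x != r -> v != r ->
  (x \in subtree v) = (x == v) || (p x \in subtree v).
Proof.
move=> xr vr; rewrite !inE; have [->|xv] := eqVneq x v; first by rewrite connect0.
apply/idP/idP => [/iter_findex E|]; last exact: connect_trans (fconnect1 _ _).
case: (findex _ _ _) E => [|k]; first by move/eqP: xv.
by rewrite iterSr => <-; apply: fconnect_iter.
Qed.

(** On the way from the root, which lies outside [S], down to [x], membership in [S] toggles exactly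
    at the flips. *)
Lemma mem_flips_parity S x : r \notin S ->
  (x \in S) = odd #|[set v in flips S | x \in subtree v]|.
Proof.
move=> rS; elim: {x}(height T x).+1 {-2}x (ltnSn (height T x)) => // k IH x hx.
have [->|xr] := eqVneq x r.
  rewrite (negPf rS); suff -> : [set v in flips S | r \in subtree v] = set0 by rewrite cards0.
  apply/setP=> v; rewrite !inE -andbA; apply/negP => /and3P[vr _].
  by have := subtree_root vr; rewrite inE => /negP.
have hp := height_parent T xr.
have := IH (p x) (leq_trans hp hx).
have xpx : p x \notin subtree x.
  rewrite inE; apply/negP => c; have [prr|pr] := eqVneq (p x) r.
    by have := subtree_root xr; rewrite inE -prr c.
  have ne : p x != x by apply: contraTneq hp => ->; rewrite ltnn.
  by have := fconnect_height pr ne c; rewrite ltnNge ltnW.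
rewrite (cardsD1 x [set v in flips S | x \in subtree v]).
have -> : [set v in flips S | x \in subtree v] :\ x =
          [set v in flips S | p x \in subtree v].
  apply/setP=> v; rewrite in_setD1 !(inE, in_set) -/(subtree v).
  have [->|vx] := eqVneq v x; first by move: xpx; rewrite inE => /negPf ->; rewrite !andbF.
  have [->//|vr] := eqVneq v r.
  by have := subtree_parent xr vr; rewrite !inE eq_sym (negPf vx) /= => ->.
move=> E; rewrite oddD -E !inE connect0 xr andbT /=.
by case: (x \in S); case: (p x \in S).
Qed.

Lemma flips_inj : {in [pred S : {set V} | r \notin S] &, injective flips}.
Proof.
move=> S S'; rewrite !inE => rS rS' E; apply/setP => x.
by rewrite (mem_flips_parity x rS) (mem_flips_parity x rS') E.
Qed.

Lemma flips_eq0 S : r \notin S -> (flips S == set0) = (S == set0).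
Proof.
move=> rS; apply/eqP/eqP => [E|->]; last by apply/setP=> v; rewrite !inE andbF.
by apply/setP=> x; rewrite (mem_flips_parity x rS) E inE; apply/negP;
  rewrite (_ : [set _ in _ | _] = set0) ?cards0 //; apply/setP=> v; rewrite !inE.
Qed.

(* A set avoiding the root is the symmetric difference of the subtrees at its
   flips, so with at most two flips laminarity leaves three shapes. *)
Lemma flips_le2 S : r \notin S -> S != set0 -> (#|flips S| <= 2)%N ->
  (exists2 v, v != r & S = subtree v) \/
  exists u v, [/\ u != r, v != r & u != v] /\
    (([disjoint subtree u & subtree v] /\ S = subtree u :|: subtree v) \/
     (subtree v \subset subtree u /\ ~: S = ~: subtree u :|: subtree v)).
Proof.
move=> rS S0; rewrite leq_eqVlt ltnS leq_eqVlt ltnS leqn0 cards_eq0 flips_eq0 //.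
rewrite (negPf S0) orbF => /orP[/cards2P[u [v [uv E]]]|/cards1P[v E]].
  have inr z : z \in flips S -> z != r by rewrite inE => /andP[].
  have ur : u != r by apply: inr; rewrite E !inE eqxx.
  have vr : v != r by apply: inr; rewrite E !inE eqxx orbT.
  have memS x : (x \in S) = (x \in subtree u) (+) (x \in subtree v).
    rewrite (mem_flips_parity x rS) E.
    have -> : [set z in [set u; v] | x \in subtree z] =
       (if x \in subtree u then [set u] else set0) :|: (if x \in subtree v then [set v] else set0).
      apply/setP=> z; rewrite in_set in_set2 in_setU.
      have [->|zu] := eqVneq z u; last have [->|zv] := eqVneq z v;
        do 2!case: ifP => ?; rewrite !inE ?eqxx ?(negPf uv) ?(negPf zu) ?(negPf zv) ?orbT //.
      by rewrite eq_sym (negPf uv).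
    do !case: ifP => _; rewrite ?setU0 ?set0U ?cards0 ?cards1 ?cards2 ?uv //.
  right; have [d|/subtree_laminar/orP[s|s]] := boolP [disjoint subtree u & subtree v].
  - exists u, v; split=> //; left; split=> //; apply/setP=> x; rewrite memS in_setU.
    by case xu: (x \in subtree u); rewrite ?(disjointFr d xu).
  - exists v, u; rewrite (eq_sym v u); split=> //; right; split=> //; apply/setP=> x.
    rewrite in_setU !in_setC memS; case xu: (x \in subtree u).
      by rewrite (subsetP s _ xu).
    by rewrite orbF.
  - exists u, v; split=> //; right; split=> //; apply/setP=> x.
    rewrite in_setU !in_setC memS; case xv: (x \in subtree v).
      by rewrite (subsetP s _ xv).
    by rewrite orbF addbF.
left; exists v; first by have: v \in flips S; [rewrite E inE|rewrite inE => /andP[]].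
apply/setP=> x; rewrite (mem_flips_parity x rS) E.
case xv: (x \in subtree v).
  rewrite (_ : [set _ in _ | _] = [set v]) ?cards1 //; apply/setP=> z; rewrite in_set.
  by apply: andb_idr => /set1P ->.
rewrite (_ : [set _ in _ | _] = set0) ?cards0 //; apply/setP=> z; rewrite in_set in_set0.
by apply/negP => /andP[/set1P ->]; rewrite xv.
Qed.

End RootedTree.

Lemma bfs_tree (V : finType) (r : V) (e : rel V) :
  (forall x, connect e r x) ->
  exists T : rooted_tree r, forall v, v != r -> e (parent T v) v.
Proof.
move=> conn.
pose B k := iter k (fun X => X :|: [set v | [exists u in X, e u v]]) [set r].
have exB v : exists k, v \in B k.
  have /connectP[q hq ->] := conn v; exists (size q).
  elim/last_ind: q hq => [|q z IH]; first by rewrite inE.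
  rewrite rcons_path size_rcons last_rcons => /andP[/IH qB ez].
  by rewrite !inE; apply/orP; right; apply/existsP; exists (last r q); rewrite qB.
pose h v := ex_minn (exB v).
have hr : h r = 0%N.
  by rewrite /h; case: ex_minnP => k _ /(_ 0%N); rewrite inE eqxx leqn0 => /(_ isT)/eqP.
have ex_pred v : v != r -> exists u, e u v && (h u < h v)%N.
  move=> vr; rewrite {2}/h; case: ex_minnP => -[|k]; first by rewrite inE (negPf vr).
  rewrite /= !inE => /orP[vB /(_ _ vB)|]; first by rewrite ltnn.
  move=> /existsP[u /andP[uB euv]] _; exists u; rewrite euv ltnS /h.
  by case: ex_minnP => j _; apply.
pose p v := if [pick u | e u v && (h u < h v)%N] is Some u then u else r.
have pP v : v != r -> e (p v) v && (h (p v) < h v)%N.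
  move=> vr; rewrite /p; case: pickP => // no.
  by have [u] := ex_pred _ vr; rewrite no.
have pr : p r = r by rewrite /p; case: pickP => // u; rewrite hr andbF.
have ph v (vr : v != r) : (h (p v) < h v)%N by have /andP[] := pP _ vr.
by exists (RootedTree pr ph) => v /pP/andP[].
Qed.

(** * Cheap spanning trees for pair costs *)

Section SpanningTree.
Variables (R : realType) (V : finType) (w : V -> V -> R) (c : R).
Hypotheses (wok : nonneg_symmetric w) (c_ge0 : 0 <= c).
Hypothesis c_le_cut : forall S : {set V}, proper_cut S -> c <= wcut w S.
Implicit Types (l : V -> V) (y : V -> V -> R).

Definition fiber l z : {set V} := [set x | l x == z].

(** Every class is a proper cut, and a crossing ordered pair is charged to the class of its first
    vertex. *)
Lemma sum_cross_ge l : (1 < #|l @: setT|)%N ->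
  c *+ #|l @: setT| <= \sum_a \sum_b w a b * (l a != l b)%:R.
Proof.
move=> l1; rewrite -sumr_const.
have -> : \sum_a \sum_b w a b * (l a != l b)%:R =
    \sum_(a in [set: V]) \sum_b w a b * (l a != l b)%:R.
  by apply: eq_bigl => a; rewrite inE.
rewrite [leRHS](partition_big_imset l) /=; apply: ler_sum => z zl.
have -> : \sum_(a in [set: V] | l a == z) \sum_b w a b * (l a != l b)%:R =
    wcut w (fiber l z).
  rewrite /wcut /between; apply: eq_big => [a|a /andP[_ /eqP lz]]; first by rewrite !inE.
  rewrite [RHS]big_mkcond; apply: eq_bigr => b _; rewrite !inE lz eq_sym.
  by case: (_ == _); rewrite ?mulr0 ?mulr1.
apply: c_le_cut; rewrite proper_cutE; apply/andP; split.
  by have /imsetP[a _ ->] := zl; apply/set0Pn; exists a; rewrite inE.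
apply: contraTneq l1 => E; rewrite -leqNgt -(cards1 z); apply: subset_leq_card.
by apply/subsetP => _ /imsetP[x _ ->]; have := in_setT x; rewrite -E !inE.
Qed.

(* Kruskal's algorithm: contract the cheapest crossing pair and subtract its cost
   everywhere; the total weight between [k] classes is at least [c * k / 2]. *)
Lemma kruskal k l y : #|l @: setT| = k.+1 ->
  (forall a b, l a != l b -> 0 <= y a b) ->
  exists F : seq (V * V), [/\ size F = k,
    forall a b, connect (fun a b => [|| l a == l b, (a, b) \in F | (b, a) \in F]) a b &
    c * \sum_(e <- F) y e.1 e.2 <= \sum_a \sum_b w a b * y a b * (l a != l b)%:R].
Proof.
have [_ w0] := wok.
elim: k l y => [|k IH] l y lk y0.
  exists [::]; split=> //.
    move=> a b; apply: connect1; have /eqP/cards1P[z lz] := lk.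
    have lE x : l x = z by apply/set1P; rewrite -lz imset_f.
    by rewrite !lE eqxx.
  rewrite big_nil mulr0; apply: sumr_ge0 => a _; apply: sumr_ge0 => b _.
  by have [|/y0 ?] := eqVneq (l a) (l b); rewrite ?mulr0 // mulr1 mulr_ge0.
have [e0 e0P] : exists e : V * V, l e.1 != l e.2.
  have /card_gt1P[_ [_ [/imsetP[a _ ->] /imsetP[b _ ->] ab]]] : (1 < #|l @: setT|)%N.
    by rewrite lk.
  by exists (a, b).
case: (@arg_minP _ _ _ e0 (fun e => l e.1 != l e.2) (fun e => y e.1 e.2) e0P).
move=> [a0 b0] /= ab0 ymin.
set m := y a0 b0 in ymin; pose y' a b := y a b - m.
pose l' x := if l x == l b0 then l a0 else l x.
have cross a b : l' a != l' b -> l a != l b.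
  by apply: contraNneq => E; rewrite /l' E.
have lk' : #|l' @: setT| = k.+1.
  have -> : l' @: setT = (l @: setT) :\ l b0.
    apply/setP=> z; rewrite in_setD1; apply/imsetP/andP=> [[x _ ->]|[zb /imsetP[x _ E]]].
      by rewrite /l'; case: ifPn => [_|xb]; rewrite ?ab0 ?xb imset_f.
    by exists x => //; rewrite /l' -E (negPf zb).
  by move: lk; rewrite (cardsD1 (l b0)) imset_f // => -[].
have y0' a b : l' a != l' b -> 0 <= y' a b.
  by move=> /cross ab; rewrite subr_ge0 (ymin (a, b)).
have [F [sF cF hF]] := IH _ _ lk' y0'.
exists ((a0, b0) :: F); split; first by rewrite /= sF.
  set rl := (X in connect X) => a b; apply: connect_sub (cF a b) => {}a {}b.
  have cl x z : l x = l z -> connect rl x z.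
    by move=> E; apply: connect1; rewrite /rl E eqxx.
  have cab : connect rl a0 b0 by apply: connect1; rewrite /rl !inE eqxx orbT.
  have cba : connect rl b0 a0 by apply: connect1; rewrite /rl !inE eqxx !orbT.
  case/orP => [/eqP|]; last first.
    by move=> abF; apply: connect1; rewrite /rl !inE; case/orP: abF => ->; rewrite !orbT.
  rewrite /l'; case: ifPn => [/eqP ab|_]; case: ifPn => [/eqP bb|_] E.
  - by apply: cl; rewrite ab bb.
  - exact: connect_trans (connect_trans (cl _ _ ab) cba) (cl _ _ E).
  - exact: connect_trans (connect_trans (cl _ _ E) cab) (cl _ _ (esym bb)).
  - exact: cl.
have m0 : 0 <= m by apply: y0.
have le1 : \sum_a \sum_b w a b * y' a b * (l' a != l' b)%:R <=
           \sum_a \sum_b w a b * y' a b * (l a != l b)%:R.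
  apply: ler_sum => a _; apply: ler_sum => b _.
  have [E|ab'] := eqVneq (l' a) (l' b); last by rewrite (cross _ _ ab').
  rewrite mulr0; have [|ab] := eqVneq (l a) (l b); rewrite ?mulr0 // mulr1.
  by rewrite mulr_ge0 // subr_ge0 (ymin (a, b)).
have E2 : \sum_a \sum_b w a b * y' a b * (l a != l b)%:R =
  \sum_a \sum_b w a b * y a b * (l a != l b)%:R -
  m * \sum_a \sum_b w a b * (l a != l b)%:R.
  rewrite mulr_sumr -sumrB; apply: eq_bigr => a _.
  by rewrite mulr_sumr -sumrB; apply: eq_bigr => b _; rewrite /y'; ring.
have E3 : \sum_(e <- F) y e.1 e.2 = \sum_(e <- F) y' e.1 e.2 + m *+ k.
  by rewrite /y' sumrB big_const_seq count_predT iter_addr_0 sF subrK.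
(* With [k + 2] classes, lowering all costs by [m] removes at least [m * c * (k + 2)] on the right,
   while the [k + 1] chosen pairs account for only [c * m * (k + 1)] on the left. *)
have := @sum_cross_ge l; rewrite lk => /(_ isT) ge2.
have := ler_wpM2l m0 ge2; rewrite big_cons /= -/m E3.
move: (le_trans hF le1); rewrite E2.
rewrite -[c *+ _]mulr_natr -[m *+ k]mulr_natr !(natrD, mulrSr).
by have := mulr_ge0 c_ge0 m0; nra.
Qed.

End SpanningTree.

(** * Averaging cuts over a spanning tree *)

Lemma sum_finset_le_seq (R : realType) (T : finType) (s : seq T) (g : T -> R) :
  (forall x, 0 <= g x) -> \sum_(x in [set x in s]) g x <= \sum_(x <- s) g x.
Proof.
move=> g0; have -> : \sum_(x in [set x in s]) g x = \sum_(x <- undup s) g x.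
  rewrite (big_uniq _ (undup_uniq s)) /=.
  by apply: eq_bigl => x; rewrite inE mem_undup.
elim: s => [|x s IH] //=; rewrite big_cons; case: ifP => _; last by rewrite big_cons lerD2l.
by apply: le_trans IH _; rewrite lerDr.
Qed.

Section TreeAverage.
Variables (R : realType) (V : finType) (r : V) (w : V -> V -> R) (c : R).
Hypotheses (wok : nonneg_symmetric w) (c_ge0 : 0 <= c).
Hypothesis c_le_cut : forall S : {set V}, proper_cut S -> c <= wcut w S.

Lemma tree_average (a : {set V} -> R) : (forall S, 0 <= a S) ->
  exists T : rooted_tree r,
    c * \sum_S a S * #|flips T S|%:R <= (\sum_S a S * wcut w S) *+ 2.
Proof.
move=> a0; pose y u v := \sum_S a S * ((u \in S) != (v \in S))%:R.
have y0 u v : 0 <= y u v by apply: sumr_ge0 => S _; rewrite mulr_ge0.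
have ys u v : y u v = y v u by apply: eq_bigr => S _; rewrite eq_sym.
have lk : #|id @: [set: V]| = #|V|.-1.+1.
  by rewrite imset_id cardsT prednK //; apply/card_gt0P; exists r.
have [F [_ cF hF]] := kruskal wok c_ge0 c_le_cut lk (fun u v _ => y0 u v).
have [|T hT] := @bfs_tree V r (fun u v => ((u, v) \in F) || ((v, u) \in F)).
  move=> x; apply: connect_sub (cF r x) => u v /orP[/eqP ->|uv]; first exact: connect0.
  exact: connect1.
exists T; apply: le_trans (_ : c * \sum_(e <- F) y e.1 e.2 <= _).
  apply: ler_wpM2l => //; apply: le_trans (sum_finset_le_seq F (fun e => y0 e.1 e.2)).
  (* [psi] picks the orientation of the parent edge that occurs in [F]; it is injective because
     heights rule out that two vertices are each other's parent. *)
  pose psi v := if (parent T v, v) \in F then (parent T v, v) else (v, parent T v).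
  have psiF v : v != r -> psi v \in F.
    by move=> /hT; rewrite /psi; case: ifP.
  have psi_inj : {in [set v | v != r] &, injective psi}.
    move=> u v; rewrite !inE => ur vr; have := height_parent T ur.
    have := height_parent T vr; rewrite /psi.
    case: ifP => _; case: ifP => _ hv hu [e1 e2] //; exfalso; move: hu hv.
      by rewrite e1 -e2; lia.
    by rewrite e2 -e1; lia.
  have -> : \sum_S a S * #|flips T S|%:R = \sum_(v in [set v | v != r]) y (psi v).1 (psi v).2.
    transitivity (\sum_(v in [set v | v != r]) y v (parent T v)); last first.
      by apply: eq_bigr => v _; rewrite /psi; case: ifP => _ //=.
    rewrite exchange_big; apply: eq_bigr => S _; rewrite -mulr_sumr; congr (_ * _).
    rewrite -sum1_card natr_sum [RHS]big_mkcond [LHS]big_mkcond; apply: eq_bigr => v _.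
    by rewrite !inE; case: (v == r) => //=; case: (_ != _).
  rewrite -(big_imset (fun e => y e.1 e.2) psi_inj) /=.
  rewrite [leRHS](bigID (mem (psi @: [set v | v != r]))) /=.
  rewrite [X in _ <= X + _](eq_bigl (mem (psi @: [set v | v != r]))) => [|e]; last first.
    rewrite /= !inE; apply: andb_idl => /imsetP[v]; rewrite inE => vr ->.
    exact: psiF.
  by rewrite lerDl; apply: sumr_ge0.
apply: le_trans hF _; rewrite -sumrMnl.
apply: le_trans (_ : \sum_u \sum_v w u v * y u v <= _).
  have [_ w0] := wok; apply: ler_sum => u _; apply: ler_sum => v _.
  by case: (_ != _); rewrite ?mulr1 // mulr0 mulr_ge0.
rewrite le_eqVlt; apply/orP; left; apply/eqP.
under eq_bigr => u _ do under eq_bigr => v _ do rewrite mulr_sumr.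
under eq_bigr => u _ do rewrite exchange_big /=.
rewrite exchange_big; apply: eq_bigr => S _ /=.
rewrite -mulrnAr -sum_sep_wcut // mulr_sumr; apply: eq_bigr => u _.
by rewrite mulr_sumr; apply: eq_bigr => v _; ring.
Qed.

Lemma sum_expr_card (x : R) : \sum_(F : {set V}) x ^+ #|F| = (1 + x) ^+ #|V|.
Proof.
have := bigA_distr 1 +%R (fun=> x) (fun=> 1 : R) (I := V).
rewrite prodr_const addrC => ->; apply: eq_bigr => F _.
by rewrite -big_mkcond /= prodr_const.
Qed.

(* Weighting [S] by [a S = exp (- theta * wcut w S / c)] and using [1 + z <= exp z]
   for [z = theta * wcut w S / c - theta / 2 * #|flips T S|], whose [a]-average is
   nonnegative by [tree_average], compares the sum with the one over the flip sets. *)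
Lemma sum_exp_cut_le (theta : R) : 0 < c -> 0 <= theta ->
  \sum_(S | proper_cut S && (r \notin S)) expR (- (theta * (wcut w S / c))) <=
  (1 + expR (- (theta / 2))) ^+ #|V| - 1.
Proof.
move=> c0 th0; pose ok (S : {set V}) := proper_cut S && (r \notin S).
pose a S := if ok S then expR (- (theta * (wcut w S / c))) else 0.
have a0 S : 0 <= a S by rewrite /a; case: ifP => // _; apply: expR_ge0.
have [T hT] := tree_average a0; pose x := expR (- (theta / 2)).
apply: le_trans (_ : \sum_(S | ok S) x ^+ #|flips T S| <= _).
  pose z S := theta * (wcut w S / c) - theta / 2 * #|flips T S|%:R.
  apply: le_trans (_ : \sum_(S | ok S) a S * (1 + z S) <= _); last first.
    apply: ler_sum => S okS; rewrite /x -expRM_natr /a okS.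
    rewrite (_ : - (theta / 2) * _ = - (theta * (wcut w S / c)) + z S); last first.
      by rewrite /z; ring.
    by rewrite expRD ler_wpM2l ?expR_ge0 // expR_ge1Dx.
  rewrite [leLHS](eq_bigr a) => [|S okS]; last by rewrite /a /ok okS.
  rewrite -subr_ge0 -sumrB.
  rewrite (eq_bigr (fun S => a S * z S)) => [|S _]; last by ring.
  rewrite big_mkcond (eq_bigr (fun S => a S * z S)) => [|S _]; last first.
    by rewrite /a; case: (ok S); rewrite ?mul0r.
  have -> : \sum_S a S * z S = theta / (c * 2) *
     ((\sum_S a S * wcut w S) *+ 2 - c * \sum_S a S * #|flips T S|%:R).
    rewrite -sumrMnl mulr_sumr -sumrB mulr_sumr; apply: eq_bigr => S _.
    by rewrite /z; field; rewrite gt_eqF.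
  by rewrite mulr_ge0 ?subr_ge0 // divr_ge0 // mulr_ge0 // ltW.
have inj : {in [set S | ok S] &, injective (flips T)}.
  by move=> S S'; rewrite !inE => /andP[_ rS] /andP[_ rS']; apply: flips_inj; rewrite inE.
(* The subtracted 1 is the term of the empty flip set, which no proper cut avoiding [r] has. *)
rewrite -sum_expr_card [X in _ <= X - 1](bigD1 set0) //= cards0 expr0.
rewrite [leRHS]addrAC subrr add0r.
rewrite (eq_bigl (mem [set S | ok S])) => [|S]; last by rewrite /= inE.
rewrite -(big_imset (fun F : {set V} => x ^+ #|F|) inj) /= -/x.
rewrite [leRHS](bigID (mem (flips T @: [set S | ok S]))) /=.
rewrite (eq_bigl (fun F => (F != set0) && (F \in flips T @: [set S | ok S]))) => [|F].
  by rewrite lerDl; apply: sumr_ge0 => F _; rewrite exprn_ge0 ?expR_ge0.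
symmetry; apply: andb_idl => /imsetP[S]; rewrite inE => /andP[pS rS] ->.
by rewrite flips_eq0 //; move: pS; rewrite proper_cutE => /andP[].
Qed.

End TreeAverage.

(** * Search plans from a known graph *)

Section Cover.
Variables (R : realType) (V : finType) (r : V) (w : V -> V -> R) (tau : R).
Hypotheses (wok : nonneg_symmetric w) (tau_gt0 : 0 < tau).
Hypothesis tau_le_cut : forall S : {set V}, proper_cut S -> tau <= wcut w S.
Implicit Types (Cs : {set {set V}}).

Definition near_mincut (S : {set V}) :=
  [&& proper_cut S, r \notin S & 8 * wcut w S <= 9 * tau].

Definition over2 (T : rooted_tree r) : {set {set V}} := [set S | 2 < #|flips T S|]%N.

(* The flips of near-minimum cuts average at most 9/4 for a suitable tree. *)
Lemma tree_2respects_quarter Cs : (forall S, S \in Cs -> near_mincut S) ->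
  exists T : rooted_tree r, (4 * #|Cs :&: over2 T| <= 3 * #|Cs|)%N.
Proof.
move=> nearC; have a0 (S : {set V}) : 0 <= (S \in Cs)%:R :> R by [].
have [T hT] := tree_average r wok (ltW tau_gt0) tau_le_cut a0; exists T.
set bad := Cs :&: over2 T.
have le1 : (3 * #|bad| <= \sum_(S in Cs) #|flips T S|)%N.
  rewrite mulnC -sum_nat_const [leqRHS](big_setID (over2 T)) /= -/bad.
  by rewrite -[leqLHS]addn0 leq_add // leq_sum // => S; rewrite !inE => /andP[].
have le2 : (4 * \sum_(S in Cs) #|flips T S| <= 9 * #|Cs|)%N.
  rewrite -(ler_nat R) !natrM -(ler_pM2l tau_gt0).
  have E1 : \sum_S (S \in Cs)%:R * #|flips T S|%:R = (\sum_(S in Cs) #|flips T S|)%:R :> R.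
    rewrite natr_sum [RHS]big_mkcond; apply: eq_bigr => S _.
    by case: (S \in Cs); rewrite ?mul1r ?mul0r.
  have E2 : 8 * \sum_S (S \in Cs)%:R * wcut w S <= 9 * tau * #|Cs|%:R.
    rewrite mulr_natr -sumr_const mulr_sumr [leRHS]big_mkcond; apply: ler_sum => S _.
    case: ifP => [/nearC/and3P[_ _]|_]; last by rewrite mul0r mulr0.
    by rewrite mul1r.
  by move: hT; rewrite E1 -mulr_natr; lra.
by lia.
Qed.

Lemma card_2respecting (T : rooted_tree r) Cs :
  (forall S, S \in Cs -> [/\ r \notin S, S != set0 & (#|flips T S| <= 2)%N]) ->
  (#|Cs| <= #|V| ^ 2)%N.
Proof.
move=> hC; rewrite -(card_in_imset (f := flips T)); last first.
  by move=> S S' /hC[rS _ _] /hC[rS' _ _]; apply: flips_inj; rewrite inE.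
apply: leq_trans (_ : #|[set [set e.1; e.2] | e in [set: V * V]]| <= _)%N; last first.
  by rewrite (leq_trans (leq_imset_card _ _)) // cardsT card_prod mulnn.
apply/subset_leq_card/subsetP => _ /imsetP[S /hC[rS S0 le2] ->]; apply/imsetP.
have := flips_eq0 T rS; rewrite (negPf S0).
move: le2; case E: #|flips T S| => [|[|[|]]] // _; last 1 first.
- by move/eqP/cards2P: E => [u [v [_ ->]]] _; exists (u, v).
- by move/cards0_eq: E ->; rewrite eqxx.
- by move/eqP/cards1P: E => [u ->] _; exists (u, u); last exact/esym/setUid.
Qed.

(** One tree is crossed at most twice by a quarter of these cuts, and at most [#|V| ^ 2] cuts can do
    that. *)
Lemma card_near_mincut : (#|[set S | near_mincut S]| <= 4 * #|V| ^ 2)%N.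
Proof.
set Cs := [set S | _]; have nearC S : S \in Cs -> near_mincut S by rewrite inE.
have [T hT] := tree_2respects_quarter nearC.
have : (#|Cs :\: over2 T| <= #|V| ^ 2)%N.
  apply: (@card_2respecting T) => S; rewrite !inE -leqNgt.
  move=> /andP[-> /and3P[pS -> _]]; split=> //.
  by move: pS; rewrite proper_cutE => /andP[].
have := cardsID (over2 T) Cs; move: hT.
move: #|Cs| #|Cs :&: _| #|Cs :\: _| (_ ^ 2)%N => a b d q; lia.
Qed.

(** Each new tree leaves at most 3/4 of the cuts uncovered, until fewer than one remains. *)
Lemma greedy_cover k Cs : (forall S, S \in Cs -> near_mincut S) ->
  (3 ^ k * #|Cs| < 4 ^ k)%N ->
  exists2 Ts : seq (rooted_tree r), size Ts = k &
    forall S, S \in Cs -> has (fun T => #|flips T S| <= 2)%N Ts.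
Proof.
elim: k Cs => [|k IH] Cs nearC hk.
  exists [::] => // S SC; move: hk; rewrite (cardsD1 S) SC; lia.
have [T hT] := tree_2respects_quarter nearC.
have [||Ts sT cT] := IH (Cs :&: over2 T).
- by move=> S; rewrite inE => /andP[/nearC].
- by move: hk; rewrite !expnS; nia.
exists (T :: Ts); first by rewrite /= sT.
move=> S SC /=; case: leqP => //= lt2; apply: cT.
by rewrite !inE SC.
Qed.

(** As [27 * 2 <= 64], three trees at least halve the uncovered cuts, and there are fewer than
    [2 ^ (2 * L + 3)] at the start. *)
Lemma tree_cover L : (#|V| < 2 ^ L)%N ->
  exists2 Ts : seq (rooted_tree r), size Ts = (3 * (2 * L + 3))%N &
    forall S, near_mincut S -> has (fun T => #|flips T S| <= 2)%N Ts.
Proof.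
move=> hL; have nearC S : S \in [set S | near_mincut S] -> near_mincut S by rewrite inE.
have [|Ts sT cT] := greedy_cover (k := 3 * (2 * L + 3)) nearC.
  rewrite !expnM; apply: leq_ltn_trans (_ : (27 ^ (2 * L + 3) * (4 * 2 ^ (2 * L)) < _)%N).
    rewrite leq_mul2l (leq_trans card_near_mincut) ?orbT //.
    by rewrite leq_mul2l /= mulnC expnM leq_exp2r // ltnW.
  rewrite (_ : (4 * 2 ^ (2 * L))%N = (2 ^ (2 * L + 2))%N); last first.
    by rewrite addnC expnD.
  apply: leq_trans (_ : (27 ^ (2 * L + 3) * 2 ^ (2 * L + 3) <= _)%N).
    by rewrite ltn_pmul2l ?expn_gt0 // ltn_exp2l // ltn_add2l.
  by rewrite -expnMn leq_exp2r // addn3.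
by exists Ts => // S nS; apply: cT; rewrite inE.
Qed.

End Cover.

(** * Chains of subtrees of similar size *)

Section TreeClasses.
Variables (V : finType) (r : V) (T : rooted_tree r) (L : nat).
Hypothesis card_lt_exp : (#|V| < 2 ^ L)%N.
Local Notation D := (subtree T).
Implicit Types (u v x : V) (A : {set V}).

Definition rank v := trunc_log 2 #|D v|.

Definition nested u v := (D u \subset D v) || (D v \subset D u).

(* Within one rank nestedness is transitive, because two disjoint subtrees of rank
   [k] do not fit in a third one; so the classes are chains, and every chain of
   subtrees meets at most [L] classes. *)
Definition chain_class v : {set V} := [set u | (rank u == rank v) && nested u v].

Lemma nested_sym u v : nested u v = nested v u.
Proof. by rewrite /nested orbC. Qed.

Lemma nested_or_disjoint u v : nested u v || [disjoint D u & D v].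
Proof. by rewrite orbC -implyNb; apply/implyP => /subtree_laminar. Qed.

Lemma subtree_not_disjoint u v x : x \in D u -> x \in D v -> ~~ [disjoint D u & D v].
Proof. by move=> xu xv; apply/pred0Pn; exists x; rewrite /= xu. Qed.

Lemma card_subtree_gt0 v : (0 < #|D v|)%N.
Proof. by apply/card_gt0P; exists v; apply: subtree_refl. Qed.

Lemma rank_bounds v : (2 ^ rank v <= #|D v| < 2 ^ (rank v).+1)%N.
Proof. exact: trunc_log_bounds (card_subtree_gt0 v). Qed.

Lemma rank_lt v : (rank v < L)%N.
Proof.
rewrite -(ltn_exp2l (m := 2)) //; have /andP[le _] := rank_bounds v.
by apply: leq_ltn_trans le _; apply: leq_ltn_trans (max_card _) card_lt_exp.
Qed.

Lemma nested_trans u v x : rank u = rank v -> rank v = rank x ->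
  nested u v -> nested v x -> nested u x.
Proof.
move=> ruv rvx /orP[uv|vu] /orP[vx|xv].
- by rewrite /nested (subset_trans uv vx).
- have := nested_or_disjoint u x; case/orP=> // dux.
  have : (#|D u :|: D x| <= #|D v|)%N by apply: subset_leq_card; rewrite subUset uv.
  have := rank_bounds u; have := rank_bounds x; have := rank_bounds v.
  rewrite cardsU (_ : D u :&: D x = set0) ?cards0; last by apply/eqP; rewrite setI_eq0.
  rewrite ruv -rvx expnS; lia.
- have := nested_or_disjoint u x; case/orP=> // /negP[]; apply/negP.
  by apply: (@subtree_not_disjoint _ _ v); [apply: subsetP vu _ _|apply: subsetP vx _ _];
    apply: subtree_refl.
- by rewrite /nested (subset_trans xv vu) orbT.
Qed.

Lemma mem_chain_class v : v \in chain_class v.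
Proof. by rewrite inE eqxx /nested subxx. Qed.

Lemma chain_class_eq u v : rank u = rank v -> nested u v -> chain_class u = chain_class v.
Proof.
move=> ruv nuv; apply/setP=> x; rewrite !inE ruv.
have [rx|//] := eqVneq (rank x) (rank v); rewrite /=.
apply/idP/idP => nx; first by apply: nested_trans nx nuv; rewrite ?rx ?ruv.
by apply: nested_trans nx _; rewrite 1?nested_sym ?rx ?ruv.
Qed.

Lemma chain_class_nested u v : chain_class u = chain_class v -> nested u v.
Proof. by move=> E; have := mem_chain_class u; rewrite E inE => /andP[]. Qed.

Lemma leq_card_bigcup (I : finType) (K : finType) (F : I -> {set K}) :
  (#|\bigcup_i F i| <= \sum_i #|F i|)%N.
Proof.
apply: (big_ind2 (fun (X : {set K}) n => #|X| <= n)%N) => [|X m Y n hX hY|//].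
  by rewrite cards0.
by rewrite (leq_trans (leq_card_setU _ _)) // leq_add.
Qed.

(** Members of different classes of one rank are disjoint, so each of the [L] ranks contributes at
    most two classes. *)
Lemma few_chain_classes A :
  (forall u v x, u \in A -> v \in A -> x \in A ->
     [disjoint D u & D v] -> [disjoint D v & D x] -> [disjoint D x & D u] -> False) ->
  (#|chain_class @: A| <= 2 * L)%N.
Proof.
move=> no3; pose F (k : 'I_L) := chain_class @: [set v in A | rank v == k].
apply: leq_trans (_ : #|\bigcup_k F k| <= _)%N.
  apply/subset_leq_card/subsetP => _ /imsetP[v vA ->].
  by apply/bigcupP; exists (Ordinal (rank_lt v)) => //; apply: imset_f; rewrite inE vA /=.
apply: leq_trans (leq_card_bigcup _) _.
apply: leq_trans (_ : \sum_(k < L) 2 <= _)%N; last by rewrite sum_nat_const card_ord mulnC.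
apply: leq_sum => k _; rewrite leqNgt; apply/negP => /card_gt2P.
move=> [_ [_ [_ [[/imsetP[u uA ->] /imsetP[v vA ->] /imsetP[x xA ->]]]]]].
move: uA vA xA; rewrite !inE => /andP[uA /eqP ru] /andP[vA /eqP rv] /andP[xA /eqP rx].
have dis y z : rank y = k -> rank z = k -> chain_class y != chain_class z -> [disjoint D y & D z].
  move=> ry rz; have := nested_or_disjoint y z; case/orP=> // nyz.
  by rewrite (chain_class_eq _ nyz) ?eqxx // ry rz.
by move=> [/dis uv /dis vx /dis xu]; apply: (no3 u v x); auto.
Qed.

End TreeClasses.

(** * Blocks of a relation between chains *)

Section Blocks.
Variable V : finType.
Implicit Types (s : seq {set V}) (b : seq {set V} * seq {set V}).

Definition is_chain s := forall A B, A \in s -> B \in s -> (A \subset B) || (B \subset A).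

(** The Monge argument exchanges columns between rows, so disjointness is asked of all entries, and
    properness makes every queried union a candidate. *)
Definition searchable b := [/\ is_chain b.1, is_chain b.2 &
  forall X Y, X \in b.1 -> Y \in b.2 -> [disjoint X & Y] /\ proper_cut (X :|: Y)].

Definition block_cost b := (size b.1 + size b.2)%N.

Lemma sum_class_partners (K : finType) (key : V -> K) (rel : rel V) N :
  (forall u, #|key @: [set v | rel u v]| <= N)%N ->
  (\sum_(e : K * K) #|[set u | (key u == e.1) && [exists v, (key v == e.2) && rel u v]]|
     <= N * #|V|)%N.
Proof.
move=> hN.
apply: (@leq_trans (\sum_(u : V) #|key @: [set v | rel u v]|)); last first.
  by rewrite mulnC -sum_nat_const leq_sum.
under [leqLHS]eq_bigr => e _ do rewrite -sum1_card big_mkcond /=.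
rewrite [leqLHS]exchange_big /=; apply: leq_sum => u _.
rewrite -big_mkcond sum1_card.
apply: leq_trans (leq_imset_card (pair (key u)) _); apply/subset_leq_card/subsetP => -[a b].
move=> h; have {h} : u \in [set u | (key u == a) && [exists v, (key v == b) && rel u v]] := h.
rewrite inE => /andP[/eqP <- /existsP[v /andP[/eqP <- uv]]].
by apply: imset_f; apply: imset_f; rewrite inE.
Qed.

(** One block per pair of classes, keeping only rows and columns with a partner in it; a vertex is
    thus a row in at most [N] blocks, and a column in at most [N]. The third hypothesis carries over
    to all entries of a block what is known for related pairs. *)
Lemma blocks_of_relation (K : finType) (key : V -> K) (rl : rel V)
    (X D : V -> {set V}) (N : nat) :
  (forall u u', key u = key u' -> (X u \subset X u') || (X u' \subset X u)) ->
  (forall v v', key v = key v' -> (D v \subset D v') || (D v' \subset D v)) ->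
  (forall u v u' v', key u = key u' -> key v = key v' -> rl u v -> rl u' v' ->
     [disjoint X u & D v'] /\ proper_cut (X u :|: D v')) ->
  (forall u, #|key @: [set v | rl u v]| <= N)%N ->
  (forall v, #|key @: [set u | rl u v]| <= N)%N ->
  exists bl, [/\ forall b, b \in bl -> searchable b,
    (\sum_(b <- bl) block_cost b <= 2 * N * #|V|)%N &
    forall u v, rl u v -> exists b, [/\ b \in bl, X u \in b.1 & D v \in b.2]].
Proof.
move=> chX chD dis nr nc.
pose rows (e : K * K) := [set u | (key u == e.1) && [exists v, (key v == e.2) && rl u v]].
pose cols (e : K * K) := [set v | (key v == e.2) && [exists u, (key u == e.1) && rl u v]].
pose blk e := ([seq X u | u <- enum (rows e)], [seq D v | v <- enum (cols e)]).
exists [seq blk e | e <- enum [set: K * K]]; split.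
- move=> _ /mapP[e _ ->]; split.
  + move=> A B /mapP[u]; rewrite mem_enum inE => /andP[/eqP ku _] ->.
    move=> /mapP[v]; rewrite mem_enum inE => /andP[/eqP kv _] ->.
    by apply: chX; rewrite ku kv.
  + move=> A B /mapP[u]; rewrite mem_enum inE => /andP[/eqP ku _] ->.
    move=> /mapP[v]; rewrite mem_enum inE => /andP[/eqP kv _] ->.
    by apply: chD; rewrite ku kv.
  + move=> A B /mapP[u]; rewrite mem_enum inE => /andP[/eqP ku].
    move=> /existsP[v /andP[/eqP kv uv]] -> /mapP[v']; rewrite mem_enum inE.
    move=> /andP[/eqP kv' /existsP[u' /andP[/eqP ku' uv']]] ->.
    by apply: dis uv uv'; rewrite ?ku ?kv.
- rewrite big_map; under eq_bigr => e _ do rewrite /block_cost /= !size_map -!cardE.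
  rewrite big_enum /= (eq_bigl xpredT) => [|e]; last by rewrite inE.
  rewrite big_split /= -mulnA mul2n -addnn leq_add //; first exact: sum_class_partners.
  have := @sum_class_partners K key (fun v u => rl u v) N nc.
  by rewrite (reindex (fun e : K * K => (e.2, e.1))) //; exists (fun e => (e.2, e.1)) => -[].
- move=> u v uv; exists (blk (key u, key v)); split.
  + by apply: map_f; rewrite mem_enum inE.
  + apply: map_f; rewrite mem_enum inE eqxx /=; apply/existsP; exists v.
    by rewrite eqxx.
  + apply: map_f; rewrite mem_enum inE eqxx /=; apply/existsP; exists u.
    by rewrite eqxx.
Qed.

End Blocks.

Lemma has_In (I : Type) (P : pred I) (s : seq I) : has P s -> exists2 i, List.In i s & P i.
Proof.
elim: s => //= i s IH /orP[Pi|/IH[j js Pj]]; first by exists i; [left|].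
by exists j; [right|].
Qed.

Lemma In_mem (I : eqType) (i : I) (s : seq I) : i \in s -> List.In i s.
Proof. by elim: s => //= j s IH; rewrite inE => /orP[/eqP ->|/IH]; [left|right]. Qed.

(** * Plans covering the near-minimum cuts *)

Section Plan.
Variables (R : realType) (V : finType) (r : V) (H : V -> V -> R) (L : nat).
Hypotheses (Hok : nonneg_symmetric H) (card_lt_exp : (#|V| < 2 ^ L)%N).
Implicit Types (X Y S : {set V}) (bl : seq (seq {set V} * seq {set V})).

Definition covers bl S :=
  exists b X Y, [/\ b \in bl, X \in b.1, Y \in b.2 & X :|: Y = S \/ X :|: Y = ~: S].

Definition plan bl (N : nat) (Q : {set V} -> Prop) :=
  [/\ forall b, b \in bl -> searchable b, (\sum_(b <- bl) block_cost b <= N)%N &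
      forall S, Q S -> covers bl S].

Lemma plan_cat bl1 bl2 N1 N2 (Q1 Q2 : {set V} -> Prop) :
  plan bl1 N1 Q1 -> plan bl2 N2 Q2 ->
  plan (bl1 ++ bl2) (N1 + N2) (fun S => Q1 S \/ Q2 S).
Proof.
move=> [s1 c1 q1] [s2 c2 q2]; split.
- by move=> b; rewrite mem_cat => /orP[/s1|/s2].
- by rewrite big_cat leq_add.
- by move=> S [/q1|/q2] [b [X [Y [bb ? ? ?]]]]; exists b, X, Y; rewrite mem_cat bb ?orbT.
Qed.

Lemma plan_flatten (I : Type) (s : seq I) (Q : I -> {set V} -> Prop) N :
  (forall i, exists bl, plan bl N (Q i)) ->
  exists bl, plan bl (size s * N) (fun S => exists2 i, List.In i s & Q i S).
Proof.
move=> hI; elim: s => [|i s [bl hbl]].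
  by exists [::]; split; rewrite ?big_nil // => S [].
have [bl1 hbl1] := hI i; exists (bl1 ++ bl); rewrite /= mulSn.
have [? ? q] := plan_cat hbl1 hbl; split=> // S [j [<- ?|? ?]]; apply: q; first by left.
by right; exists j.
Qed.

(* A set attracts at most two pairwise disjoint others ([attracted_le2]), so it takes
   part in few blocks. *)
Definition attracted X Y := (wcut H X < 3 * between H X Y) && (wcut H Y < 3 * between H X Y).

(** By [wcutU], twice the weight between the sets is at least [wcut H X - tau / 8], so it takes up
    at least 7/16 of the cut of [X]; likewise for [Y]. *)
Lemma attractedP tau X Y : 0 < tau -> tau <= wcut H X -> tau <= wcut H Y ->
  [disjoint X & Y] -> 8 * wcut H (X :|: Y) <= 9 * tau -> attracted X Y.
Proof.
by move=> t0 tX tY dXY; rewrite (wcutU Hok dXY) => ?; apply/andP; split; lra.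
Qed.

(** Three disjoint parts, each above a third, would exceed the cut of [X]. *)
Lemma attracted_le2 X Y1 Y2 Y3 :
  [disjoint X & Y1] -> [disjoint X & Y2] -> [disjoint X & Y3] ->
  [disjoint Y1 & Y2] -> [disjoint Y2 & Y3] -> [disjoint Y3 & Y1] ->
  wcut H X < 3 * between H X Y1 -> wcut H X < 3 * between H X Y2 ->
  wcut H X < 3 * between H X Y3 -> False.
Proof.
move=> d1 d2 d3 d12 d23 d31 h1 h2 h3.
have d123 : [disjoint Y1 :|: Y2 & Y3].
  by rewrite disjoints_subset subUset -!disjoints_subset (disjoint_sym Y1) d31.
have dX : [disjoint X & Y1 :|: Y2 :|: Y3].
  by rewrite disjoint_sym disjoints_subset !subUset -!disjoints_subset !(disjoint_sym _ X) d1 d2.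
have := between_wcut_le Hok dX; rewrite !betweenUr //; lra.
Qed.

Section OneTree.
Variable T : rooted_tree r.
Local Notation D := (subtree T).
Local Notation cls := (chain_class T).

Lemma proper_cut_subtree v : v != r -> proper_cut (D v).
Proof.
move=> vr; rewrite proper_cutE; apply/andP; split.
  by apply/set0Pn; exists v; apply: subtree_refl.
by apply: contraTneq (subtree_root T vr) => ->; rewrite inE.
Qed.

(** A single subtree is a one-by-one block whose column is the empty set. *)
Lemma plan_subtrees :
  exists bl, plan bl (2 * #|V|) (fun S => exists2 v, v != r & S = D v).
Proof.
exists [seq ([:: D v], [:: set0]) | v <- enum [set v | v != r]]; split.
- move=> b /mapP[v]; rewrite mem_enum inE => vr ->; split=> /=.
  + by move=> A B; rewrite !inE => /eqP -> /eqP ->; rewrite subxx.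
  + by move=> A B; rewrite !inE => /eqP -> /eqP ->; rewrite subxx.
  + move=> A B; rewrite !inE => /eqP -> /eqP ->; rewrite setU0.
    by rewrite -setI_eq0 setI0 eqxx; split=> //; apply: proper_cut_subtree.
- rewrite big_map /block_cost /= big_const_seq count_predT iter_addn_0 leq_mul2l /=.
  by rewrite -cardE max_card.
- move=> S [v vr ->]; exists ([:: D v], [:: set0]), (D v), set0.
  rewrite !inE !eqxx setU0; split=> //; last by left.
  by apply/mapP; exists v => //; rewrite mem_enum inE.
Qed.

Lemma disjoint_pair_blocks u v u' v' : nested T u u' -> nested T v v' ->
  [disjoint D u & D v] -> [disjoint D u' & D v'] -> [disjoint D u & D v'].
Proof.
move=> nu nv duv du'v'.
have [s|vv'] := orP nv; last by apply: disjointWr vv' duv.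
have [uu'|u'u] := orP nu; first by apply: disjointWl uu' du'v'.
have /orP[/orP[uv'|v'u]|//] := nested_or_disjoint T u v'.
  have := subtree_not_disjoint (subtree_refl T u') (subsetP (subset_trans u'u uv') _ (subtree_refl T u')).
  by rewrite du'v'.
have vv := subtree_refl T v.
have := subtree_not_disjoint (subsetP v'u _ (subsetP s _ vv)) vv.
by rewrite duv.
Qed.

Lemma plan_disjoint : exists bl, plan bl (2 * (2 * L) * #|V|) (fun S =>
  exists u v, [/\ u != r, v != r & S = D u :|: D v] /\
    ([disjoint D u & D v] /\ attracted (D u) (D v))).
Proof.
pose rl u v := [&& u != r, v != r, [disjoint D u & D v] & attracted (D u) (D v)].
have [| | | | |bl [sb cb qb]] := @blocks_of_relation V _ cls rl D D (2 * L).
- by move=> u u' /chain_class_nested.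
- by move=> u u' /chain_class_nested.
- move=> u v u' v' ku kv /and4P[ur vr duv _] /and4P[u'r v'r duv' _].
  split; first by apply: disjoint_pair_blocks duv duv'; apply: chain_class_nested.
  rewrite proper_cutE; apply/andP; split.
    by apply/set0Pn; exists u; rewrite inE subtree_refl.
  apply: contraTneq (in_setT r) => <-.
  by rewrite in_setU negb_or !subtree_root.
- move=> u; apply: few_chain_classes => // v1 v2 v3; rewrite !inE.
  move=> /and4P[_ _ d1 /andP[a1 _]] /and4P[_ _ d2 /andP[a2 _]] /and4P[_ _ d3 /andP[a3 _]].
  by move=> d12 d23 d31; apply: (attracted_le2 d1 d2 d3 d12 d23 d31).
- move=> v; apply: few_chain_classes => // v1 v2 v3; rewrite !inE.
  move=> /and4P[_ _ d1 /andP[_ a1]] /and4P[_ _ d2 /andP[_ a2]] /and4P[_ _ d3 /andP[_ a3]].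
  move: d1 d2 d3 a1 a2 a3; rewrite ![[disjoint _ & D v]]disjoint_sym ![between H _ (D v)]betweenC //.
  by move=> d1 d2 d3 a1 a2 a3 d12 d23 d31; apply: (attracted_le2 d1 d2 d3 d12 d23 d31).
exists bl; split=> // S [u [v [[ur vr ->] [d a]]]].
have [|b [bb Xb Yb]] := qb u v; first by rewrite /rl ur vr d.
by exists b, (D u), (D v); split=> //; left.
Qed.

Definition size_quotient t v := (#|D v| %/ 2 ^ t)%N.

(* Consecutive quotients make every row of a block larger than every column, so that
   all pairs in it are nested, even when rows and columns come from the same chain. *)
Lemma plan_nested t : exists bl, plan bl (2 * (2 * L) * #|V|) (fun S =>
  exists u v, [/\ u != r, v != r & ~: S = ~: D u :|: D v] /\
    [/\ D v \subset D u, attracted (~: D u) (D v) & size_quotient t u = (size_quotient t v).+1]).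
Proof.
pose q := size_quotient t.
pose rl u v := [&& u != r, v != r, D v \subset D u, attracted (~: D u) (D v) & q u == (q v).+1].
pose key v := cls v :&: [set u | q u == q v].
have keyP u v : key u = key v -> nested T u v /\ q u = q v.
  move=> E; have : u \in key u by rewrite in_setI mem_chain_class inE eqxx.
  by rewrite E !inE => /andP[/andP[_ ->] /eqP ->].
(* With the quotient fixed, refining the classes by it does not increase their number. *)
have cardkey (A : {set V}) k : (forall v, v \in A -> q v = k) ->
    (#|key @: A| <= #|cls @: A|)%N.
  move=> qA; apply: leq_trans (leq_imset_card (fun C => C :&: [set u | q u == k]) _).
  apply/subset_leq_card/subsetP => _ /imsetP[v vA ->]; rewrite /key (qA _ vA).
  by apply: imset_f; apply: imset_f.
have lt_card u v : (q u < q v)%N -> (#|D u| < #|D v|)%N.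
  by rewrite ltnNge => h; rewrite ltnNge; apply: contraNN h => /leq_div2r; apply.
have [| | | | |bl [sb cb qb]] := @blocks_of_relation V _ key rl (fun u => ~: D u) D (2 * L).
- by move=> u u' /keyP[n _]; rewrite !setCS orbC.
- by move=> u u' /keyP[n _].
- move=> u v u' v' /keyP[nu qu] /keyP[nv qv] /and5P[ur vr vu _ /eqP quv] _.
  have ltu : (#|D v'| < #|D u|)%N by apply: lt_card; rewrite quv qv.
  have v'u : D v' \subset D u.
    case/orP: nv => [vv'|v'v]; last exact: subset_trans vu.
    have vD := subtree_refl T v.
    have := subtree_not_disjoint (subsetP vu _ vD) (subsetP vv' _ vD).
    move=> nd; have := nested_or_disjoint T u v'; rewrite (negPf nd) orbF => /orP[/subset_leq_card|//].
    by rewrite leqNgt ltu.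
  split; first by rewrite -setI_eq0 setIC -setDE setD_eq0.
  rewrite proper_cutE; apply/andP; split.
    by apply/set0Pn; exists r; rewrite in_setU in_setC subtree_root.
  apply: contraTneq ltu => /setP E; rewrite -leqNgt; apply/subset_leq_card/subsetP => x xu.
  by have := E x; rewrite in_setU in_setC xu in_setT.
- move=> u; apply: leq_trans (cardkey _ (q u).-1 _) _.
    by move=> v; rewrite inE => /and5P[_ _ _ _ /eqP ->].
  apply: few_chain_classes => // v1 v2 v3; rewrite !inE.
  have dC v : D v \subset D u -> [disjoint ~: D u & D v].
    by rewrite -setI_eq0 setIC -setDE setD_eq0.
  move=> /and5P[_ _ /dC d1 /andP[a1 _] _] /and5P[_ _ /dC d2 /andP[a2 _] _].
  move=> /and5P[_ _ /dC d3 /andP[a3 _] _].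
  by move=> d12 d23 d31; apply: (attracted_le2 d1 d2 d3 d12 d23 d31).
- move=> v; apply: leq_trans (cardkey _ (q v).+1 _) _.
    by move=> u; rewrite inE => /and5P[_ _ _ _ /eqP ->].
  apply: few_chain_classes => // u1 u2 u3; rewrite !inE.
  move=> /and5P[_ _ s1 _ _] /and5P[_ _ s2 _ _] _ /negPn; case/negP.
  (* Every [D u] paired with [v] contains [v], so no two of them are disjoint. *)
  have vD := subtree_refl T v.
  by apply: subtree_not_disjoint (subsetP s1 _ vD) (subsetP s2 _ vD).
exists bl; split=> // S [u [v [[ur vr E] [s a quv]]]].
have [|b [bb Xb Yb]] := qb u v; first by rewrite /rl ur vr s a /q quv eqxx.
by exists b, (~: D u), (D v); split=> //; right.
Qed.

(** Halve both numbers until one more halving would make them equal; they then differ by exactly 1.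
    So [L] scales serve all nested pairs. *)
Lemma dyadic_separation m a b : (a < b < 2 ^ m)%N ->
  exists2 t, (t < m)%N & (b %/ 2 ^ t = (a %/ 2 ^ t).+1)%N.
Proof.
elim: m a b => [|m IH] a b; first by rewrite expn0; lia.
move=> /andP[ab bm]; have [E|ne] := eqVneq (a %/ 2)%N (b %/ 2)%N.
  by exists 0%N => //; rewrite expn0 !divn1; lia.
have [|t tm E] := IH (a %/ 2)%N (b %/ 2)%N; last by exists t.+1 => //; rewrite expnS !divnMA.
by move: bm; rewrite expnS => bm; apply/andP; split; lia.
Qed.

Definition near_min2 S := exists2 tau, 0 < tau /\ (forall S, proper_cut S -> tau <= wcut H S) &
  near_mincut r H tau S /\ (#|flips T S| <= 2)%N.

Lemma plan_tree : exists bl, plan bl (10 * L ^ 2 * #|V|) near_min2.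
Proof.
have [bl1 [s1 c1 q1]] := plan_subtrees; have [bl2 hbl2] := plan_disjoint.
have [bl3 hbl3] := plan_flatten (iota 0 L) plan_nested.
have [s c q] := plan_cat hbl2 hbl3; rewrite size_iota in c.
exists (bl1 ++ (bl2 ++ bl3)); split.
- by move=> b; rewrite mem_cat => /orP[/s1|/s].
- have L0 : (0 < L)%N.
    by case: (L) card_lt_exp => //; rewrite expn0 ltnS leqn0 => /eqP/card0_eq/(_ r); rewrite inE.
  rewrite big_cat; apply: leq_trans (leq_add c1 c) _.
  have -> : (2 * #|V| + (2 * (2 * L) * #|V| + L * (2 * (2 * L) * #|V|)) =
    (2 + 4 * L + 4 * L ^ 2) * #|V|)%N by rewrite -mulnn; ring.
  by rewrite leq_mul2r -mulnn; apply/orP; right; nia.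
move=> S [tau [tau0 tauC] [nS f2]].
have hitl : covers bl1 S -> covers (bl1 ++ (bl2 ++ bl3)) S.
  by move=> [b [X [Y [bb ? ? ?]]]]; exists b, X, Y; rewrite mem_cat bb.
have hitr : covers (bl2 ++ bl3) S -> covers (bl1 ++ (bl2 ++ bl3)) S.
  by move=> [b [X [Y [bb ? ? ?]]]]; exists b, X, Y; rewrite mem_cat bb orbT.
have /and3P[pS rS S8] := nS; have S0 : S != set0 by move: pS; rewrite proper_cutE => /andP[].
have [[v vr E]|[u [v [[ur vr uv] E]]]] := flips_le2 rS S0 f2.
  by apply/hitl/q1; exists v.
have tu := tauC _ (proper_cut_subtree ur); have tv := tauC _ (proper_cut_subtree vr).
apply/hitr/q; case: E => [[d E]|[s_vu E]].
  by left; exists u, v; do !split=> //; apply: (attractedP tau0) => //; rewrite -E.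
have ltc : (#|D v| < #|D u| < 2 ^ L)%N.
  rewrite (leq_ltn_trans (max_card _) card_lt_exp) andbT proper_card // properEneq s_vu andbT.
  by apply: contraNneq uv => /esym/subtree_inj ->.
have [t tL qt] := dyadic_separation ltc.
right; exists t; first by apply: In_mem; rewrite mem_iota.
exists u, v; do !split=> //; apply: (attractedP tau0) => //.
- by rewrite wcutC.
- by rewrite -setI_eq0 setIC -setDE setD_eq0.
- by rewrite -E wcutC.
Qed.

End OneTree.

(** The trees are built for the true minimum cut of [H], which is at least every admissible [tau];
    one plan therefore serves all of them. *)
Lemma plan_exists : (1 < #|V|)%N -> exists bl, plan bl (150 * L ^ 3 * #|V|) (fun S =>
  exists2 tau, 0 < tau /\ (forall S', proper_cut S' -> tau <= wcut H S') &
    proper_cut S /\ 8 * wcut H S <= 9 * tau).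
Proof.
move=> V1.
case: (@arg_minP _ _ _ [set r] (@proper_cut V) (wcut H) (proper_cut1 r V1)) => S0 pS0 minS0.
have [tau0|tau0] := ltP 0 (wcut H S0); last first.
  (* If [H] has a cut of weight 0, no positive [tau] is admissible. *)
  exists [::]; split; rewrite ?big_nil // => S [tau [tau1 /(_ _ pS0)]].
  by move=> h; have := lt_le_trans tau1 (le_trans h tau0); rewrite ltxx.
have [Ts sT cT] := tree_cover r Hok tau0 minS0 card_lt_exp.
have [bl [s c q]] := plan_flatten Ts plan_tree.
have L0 : (0 < L)%N by case: (L) card_lt_exp => //; rewrite expn0; lia.
exists bl; split=> //.
  (* There are [3 * (2 * L + 3) <= 15 * L] trees, at [10 * L ^ 2 * #|V|] each. *)
  by apply: leq_trans c _; rewrite sT mulnA leq_mul2r; apply/orP; right; rewrite !expnS expn0; nia.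
move=> S [tau [tau1 tauC] [pS S8]].
wlog rS : S pS S8 / r \notin S.
  move=> hw; have [rS|] := boolP (r \in S); last exact: hw.
  have [||| b [X [Y [? ? ? E]]]] := hw (~: S); rewrite ?proper_cutC ?wcutC ?inE ?rS //.
  exists b, X, Y; split=> //; case: E => ->; [by right|left; exact: setCK].
have nS : near_mincut r H (wcut H S0) S.
  by rewrite /near_mincut pS rS; apply: le_trans S8 _; rewrite ler_pM2l // tauC.
have [T TTs f2] := has_In (cT S nS).
by apply: q; exists T => //; exists (wcut H S0).
Qed.

End Plan.

(** * Query algorithms and the Monge search *)

Section QueryAlgorithms.
Variables (R : realType) (V : finType) (f : {set V} -> R).
Implicit Types (A B : Type).

Fixpoint qbind A B (a : qalg R V A) (k : A -> qalg R V B) : qalg R V B :=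
  match a with
  | Ret x => k x
  | Query X c => Query X (fun v => qbind (c v) k)
  | Flip p a1 a2 => Flip p (qbind a1 k) (qbind a2 k)
  end.

Fixpoint expect A (g : A -> R) (a : qalg R V A) : R :=
  match a with
  | Ret x => g x
  | Query X c => expect g (c (f X))
  | Flip p a1 a2 => p%:num * expect g a1 + (1 - p%:num) * expect g a2
  end.

(** Sure, not almost sure: both branches of a [Flip] count, even one of probability 0. *)
Fixpoint always A (P : A -> Prop) (a : qalg R V A) : Prop :=
  match a with
  | Ret x => P x
  | Query X c => always P (c (f X))
  | Flip _ a1 a2 => always P a1 /\ always P a2
  end.

Lemma prob_outE A (P : pred A) (a : qalg R V A) :
  prob_out f P a = expect (fun x => (P x)%:R) a.
Proof. by elim: a => //= p a1 -> a2 ->. Qed.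

Lemma expect_bind A B g (a : qalg R V A) (k : A -> qalg R V B) :
  expect g (qbind a k) = expect (fun x => expect g (k x)) a.
Proof. by elim: a => //= p a1 -> a2 ->. Qed.

Lemma always_bind A B P (a : qalg R V A) (k : A -> qalg R V B) :
  always P (qbind a k) <-> always (fun x => always P (k x)) a.
Proof.
elim: a => //= p a1 IH1 a2 IH2.
by split=> -[/IH1 h1 /IH2 h2].
Qed.

Lemma always_impl A (P Q : A -> Prop) (a : qalg R V A) :
  (forall x, P x -> Q x) -> always P a -> always Q a.
Proof.
move=> PQ; elim: a => [x|X c IH|p a1 IH1 a2 IH2] /=; [exact: PQ|exact: IH|].
by move=> [/IH1 ? /IH2 ?].
Qed.

Lemma always_true A (P : A -> Prop) (a : qalg R V A) : (forall x, P x) -> always P a.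
Proof. by move=> h; elim: a => //=. Qed.

Lemma expect_le A (g h : A -> R) (a : qalg R V A) :
  always (fun x => g x <= h x) a -> expect g a <= expect h a.
Proof.
elim: a => [x|X c IH|p a1 IH1 a2 IH2] //=; first exact: IH.
move=> [/IH1 h1 /IH2 h2]; by apply: lerD; apply: ler_wpM2l; rewrite // subr_ge0.
Qed.

Lemma eq_expect A (g h : A -> R) (a : qalg R V A) :
  g =1 h -> expect g a = expect h a.
Proof. by move=> gh; elim: a => //= p a1 -> a2 ->. Qed.

Lemma expect_cst A (x : R) (a : qalg R V A) : expect (fun=> x) a = x.
Proof. by elim: a => //= p a1 -> a2 ->; ring. Qed.

Lemma expect_le_cst A (g : A -> R) (x : R) (a : qalg R V A) :
  always (fun y => g y <= x) a -> expect g a <= x.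
Proof. by move=> gx; rewrite -[leRHS](expect_cst x a); apply: expect_le. Qed.

Lemma expectD A (g h : A -> R) (a : qalg R V A) :
  expect (fun x => g x + h x) a = expect g a + expect h a.
Proof. by elim: a => //= p a1 -> a2 ->; ring. Qed.

Lemma expectZ A (x : R) (g : A -> R) (a : qalg R V A) :
  expect (fun y => x * g y) a = x * expect g a.
Proof. by elim: a => //= p a1 -> a2 ->; ring. Qed.

Lemma expect_sum A (I : finType) (P : pred I) (g : I -> A -> R) (a : qalg R V A) :
  expect (fun x => \sum_(i | P i) g i x) a = \sum_(i | P i) expect (g i) a.
Proof.
elim: a => //= p a1 -> a2 ->.
by rewrite !mulr_sumr -big_split.
Qed.

Lemma num_queries_bind A B N (a : qalg R V A) (k : A -> qalg R V B) :
  always (fun x => num_queries f (k x) <= N)%N a ->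
  (num_queries f (qbind a k) <= num_queries f a + N)%N.
Proof.
elim: a => [x|X c IH|p a1 IH1 a2 IH2] //=; first by rewrite addSn ltnS; apply: IH.
by move=> [/IH1 h1 /IH2 h2]; lia.
Qed.

Fixpoint query_all (s : seq {set V}) : qalg R V (seq R) :=
  if s is X :: s' then Query X (fun v => qbind (query_all s') (fun vs => Ret R V (v :: vs)))
  else Ret R V [::].

Lemma query_allP s : always (fun vs => vs = [seq f X | X <- s]) (query_all s).
Proof.
elim: s => //= X s IH; apply/always_bind; apply: always_impl IH => vs -> //=.
Qed.

Lemma num_query_all s : num_queries f (query_all s) = size s.
Proof.
elim: s => //= X s IH; congr _.+1; apply/eqP; rewrite eqn_leq -IH; apply/andP; split.
  by rewrite -[leqRHS]addn0; apply: num_queries_bind; apply: always_true.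
elim: (query_all s) => [x|Y c IHc|p a1 h1 a2 h2] //=; first exact: IHc.
by rewrite geq_max !leq_max h1 h2 orbT.
Qed.

Definition argmin (vs : seq R) := find (fun v => all (fun u => v <= u) vs) vs.

Lemma argminP vs : (0 < size vs)%N ->
  (argmin vs < size vs)%N /\ (forall i, (i < size vs)%N -> vs`_(argmin vs) <= vs`_i).
Proof.
move=> vs0; have hm : has (fun v => all (fun u => v <= u) vs) vs.
  case: vs vs0 => // v vs _; elim: vs v => [v|u vs IH v]; first by rewrite /= lexx.
  have /hasP[m ms /allP mmin] := IH v.
  have [mu|um] := leP m u; apply/hasP; [exists m|exists u].
  - by move: ms; rewrite !inE => /orP[->|->]; rewrite ?orbT.
  - apply/allP => x; rewrite !inE => /or3P[xv|/eqP -> //|xs]; apply: mmin; rewrite inE.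
      by rewrite xv.
    by rewrite xs orbT.
  - by rewrite !inE eqxx orbT.
  - apply/allP => x; rewrite !inE => /or3P[xv|/eqP -> //|xs]; apply: le_trans (ltW um) _;
      apply: mmin; rewrite inE; by rewrite ?xv ?xs ?orbT.
split; first by rewrite -has_find.
by move=> i ivs; have /allP := nth_find 0 hm; apply; apply: mem_nth.
Qed.

Definition best : Type := {set V} * R.

Definition valid (r : best) : Prop := proper_cut r.1 /\ r.2 = f r.1.

Definition improve (acc : best) S v : best := if v < acc.2 then (S, v) else acc.

Lemma improve_le acc S v : (improve acc S v).2 <= acc.2 /\ (improve acc S v).2 <= v.
Proof. by rewrite /improve; case: ltP => // /ltW. Qed.

Lemma improve_valid acc S : proper_cut S -> valid acc -> valid (improve acc S (f S)).
Proof. by rewrite /improve; case: ifP. Qed.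

Fixpoint search h (rs cs : seq {set V}) acc : qalg R V best :=
  if h is h'.+1 then
    if nilp rs || nilp cs then Ret R V acc else
    let m := (size rs)./2 in let X := nth set0 rs m in
    qbind (query_all [seq X :|: Y | Y <- cs]) (fun vs =>
    let j := argmin vs in
    qbind (search h' (take m rs) (take j.+1 cs) (improve acc (X :|: nth set0 cs j) vs`_j))
      (search h' (drop m.+1 rs) (drop j cs)))
  else Ret R V acc.

(** Both halves keep the best column but neither keeps the middle row, so the total of rows and
    columns does not grow from level to level. *)
Lemma num_search h rs cs acc : (size rs < 2 ^ h)%N ->
  (num_queries f (search h rs cs acc) <= h * (size rs + size cs))%N.
Proof.
elim: h rs cs acc => [//|h IH] rs cs acc hrs /=.
have [//|] := boolP (nilp rs || nilp cs); rewrite negb_or /nilp -!lt0n => /andP[rs0 cs0].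
set m := _./2; set X := nth _ _ m; have mE : m = (size rs %/ 2)%N by rewrite /m divn2.
pose N := (h * (size rs + size cs))%N.
apply: leq_trans (_ : size cs + N <= _)%N; last by rewrite /N; lia.
rewrite -[X in (_ <= X + _)%N](size_map (fun Y => X :|: Y)) -num_query_all.
apply: num_queries_bind; apply: always_impl (query_allP _) => vs Evs.
have svs : size vs = size cs by rewrite Evs !size_map.
have [|jlt _] := @argminP vs; rewrite ?svs //; set j := argmin vs in jlt *.
have h1 : (size (take m rs) < 2 ^ h)%N.
  by rewrite size_take; move: hrs; rewrite expnS; case: ifP; lia.
have h2 : (size (drop m.+1 rs) < 2 ^ h)%N.
  by rewrite size_drop; move: hrs; rewrite expnS; lia.
apply: leq_trans (_ : h * (size (take m rs) + size (take j.+1 cs)) +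
                      h * (size (drop m.+1 rs) + size (drop j cs)) <= _)%N; last first.
  rewrite /N -mulnDr leq_mul2l; apply/orP; right; rewrite !size_drop !size_take.
  by do 2!case: ifP; rewrite ?svs; lia.
apply: leq_trans (num_queries_bind (N := h * (size (drop m.+1 rs) + size (drop j cs))) _) _.
  by apply: always_true => acc'; apply: IH.
by rewrite leq_add2r IH.
Qed.

End QueryAlgorithms.

Lemma mem_drop_nth (T : eqType) (x0 : T) (s : seq T) i k :
  (k <= i < size s)%N -> nth x0 s i \in drop k s.
Proof.
by move=> /andP[ki si]; rewrite -(subnKC ki) -nth_drop mem_nth // size_drop ltn_sub2r // (leq_ltn_trans ki).
Qed.

Lemma mem_take_nth (T : eqType) (x0 : T) (s : seq T) i k :
  (i < k)%N -> (i < size s)%N -> nth x0 s i \in take k s.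
Proof.
by move=> ik si; rewrite -(nth_take x0 ik) mem_nth // size_take; case: ifP.
Qed.

(** * Exact search in Monge blocks *)

Section MongeSearch.
Variables (R : realType) (V : finType) (w : V -> V -> R).
Hypothesis wok : nonneg_symmetric w.
Local Notation f := (wcut w).
Implicit Types (X Y : {set V}).

Definition supset : rel {set V} := fun X Y => Y \subset X.

Lemma supset_trans : transitive supset.
Proof. by move=> X Y Z YX XZ; apply: subset_trans XZ YX. Qed.

(** The two sides differ by twice the weight between [X :\: X'] and [Y :\: Y']. *)
Lemma monge X X' Y Y' : [disjoint X & Y] -> X' \subset X -> Y' \subset Y ->
  f (X :|: Y) + f (X' :|: Y') <= f (X :|: Y') + f (X' :|: Y).
Proof.
move=> dXY sX sY.
have dX'Y := disjointWl sX dXY; have dXY' := disjointWr sY dXY.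
have dX'Y' := disjointWl sX dXY'.
have dD (A B : {set V}) : A \subset B -> [disjoint A & B :\: A] /\ A :|: (B :\: A) = B.
  move=> AB; split; first by rewrite -setI_eq0; apply/eqP/setP => x; rewrite !inE; case: (x \in A).
  by apply/setP=> x; rewrite !inE; case: (boolP (x \in A)) => // /(subsetP AB) ->.
have [dx EX] := dD _ _ sX; have [dy EY] := dD _ _ sY.
have B0 := between_ge0 (X :\: X') (Y :\: Y') wok.
have EXb B : between w X B = between w X' B + between w (X :\: X') B.
  by rewrite -{1}EX betweenUl.
have EYb A : between w A Y = between w A Y' + between w A (Y :\: Y').
  by rewrite -{1}EY betweenUr.
by rewrite !wcutU // !EXb !EYb; lra.
Qed.

(* By [monge] the best column moves monotonically with the row, so the best column of
   the middle row bounds the columns worth trying on either side of it. *)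
Lemma search_spec h rs cs acc : (size rs < 2 ^ h)%N ->
  sorted supset rs -> sorted supset cs ->
  (forall X Y, X \in rs -> Y \in cs -> [disjoint X & Y] /\ proper_cut (X :|: Y)) ->
  always f (fun res : best R V => [/\ valid f acc -> valid f res, res.2 <= acc.2 &
    forall X Y, X \in rs -> Y \in cs -> res.2 <= f (X :|: Y)]) (search h rs cs acc).
Proof.
elim: h rs cs acc => [|h IH] rs cs acc hrs srs scs dis.
  by have /size0nil -> : size rs = 0%N by move: hrs; rewrite expn0; lia.
rewrite /=; case: ifPn => [/orP[/nilP ->|/nilP ->] //|].
rewrite negb_or /nilp -!lt0n => /andP[rs0 cs0].
set m := _./2; set X0 := nth _ _ m; have mE : m = (size rs %/ 2)%N by rewrite /m divn2.
have mrs : (m < size rs)%N by lia.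
have X0rs : X0 \in rs by apply: mem_nth.
apply/always_bind; apply: always_impl (query_allP _ _) => vs Evs.
have svs : size vs = size cs by rewrite Evs !size_map.
have [|jlt jmin] := @argminP _ vs; rewrite ?svs //; set j := argmin vs in jlt jmin *.
rewrite svs in jlt jmin; set Y0 := nth set0 cs j.
have vsE i : (i < size cs)%N -> vs`_i = f (X0 :|: nth set0 cs i).
  by move=> ics; rewrite Evs -map_comp (nth_map set0).
have Y0cs : Y0 \in cs by apply: mem_nth.
rewrite vsE //; set acc1 := improve acc _ _.
have h1 : (size (take m rs) < 2 ^ h)%N.
  by rewrite size_take; move: hrs; rewrite expnS; case: ifP; lia.
have h2 : (size (drop m.+1 rs) < 2 ^ h)%N.
  by rewrite size_drop; move: hrs; rewrite expnS; lia.
have ord s i k : sorted supset s -> (i <= k < size s)%N -> nth set0 s k \subset nth set0 s i.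
  move=> ss /andP[ik ks]; apply: (sorted_leq_nth supset_trans _ set0 ss) => //.
  - by move=> X; rewrite /supset subxx.
  - by rewrite inE (leq_ltn_trans ik).
apply/always_bind; apply: always_impl (IH _ _ acc1 h1 (take_sorted _ srs) (take_sorted _ scs) _).
  move=> acc2 [v12 l12 c12].
  apply: always_impl (IH _ _ acc2 h2 (drop_sorted _ srs) (drop_sorted _ scs) _); last first.
    by move=> X Y /mem_drop Xr /mem_drop Yc; apply: dis.
  have [l01 l01'] := improve_le acc (X0 :|: Y0) (f (X0 :|: Y0)).
  move=> res [v2 l2 c2]; split.
  - by move=> v; apply/v2/v12/improve_valid => //; have [] := dis _ _ X0rs Y0cs.
  - exact: le_trans l2 (le_trans l12 l01).
  move=> X Y /(nthP set0)[i irs <-] /(nthP set0)[k kcs <-].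
  set Xi := nth _ rs i; set Yk := nth _ cs k.
  have Xrs : Xi \in rs by apply: mem_nth.
  have Ycs : Yk \in cs by apply: mem_nth.
  have jk := jmin _ kcs; rewrite !vsE // -/Y0 -/Yk in jk.
  have [dX0Y _] := dis _ _ X0rs Ycs; have [dXY0 _] := dis _ _ Xrs Y0cs.
  have [im|mi|E] := ltngtP i m; last first.
  - rewrite /Xi E; apply: le_trans jk.
    exact: le_trans l2 (le_trans l12 l01').
  - have Xd : Xi \in drop m.+1 rs by apply: mem_drop_nth; rewrite mi.
    have [jk'|kj] := leqP j k.
      by apply: c2 => //; apply: mem_drop_nth; rewrite jk'.
    have XX0 : Xi \subset X0 by apply: ord => //; rewrite (ltnW mi).
    have Y0Y : Y0 \subset Yk by apply: ord => //; rewrite (ltnW kj).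
    have Yd : Y0 \in drop j cs by apply: mem_drop_nth; rewrite leqnn.
    by have := monge dX0Y XX0 Y0Y; have := c2 _ _ Xd Yd; lra.
  - have Xt : Xi \in take m rs by apply: mem_take_nth.
    have [kj|jk'] := leqP k j.
      by apply: le_trans l2 _; apply: c12 => //; apply: mem_take_nth.
    have X0X : X0 \subset Xi by apply: ord => //; rewrite (ltnW im).
    have YY0 : Yk \subset Y0 by apply: ord => //; rewrite (ltnW jk').
    have Yt : Y0 \in take j.+1 cs by apply: mem_take_nth.
    by have := monge dXY0 X0X YY0; have := c12 _ _ Xt Yt; lra.
by move=> X Y /mem_take Xr /mem_take Yc; apply: dis.
Qed.

Fixpoint search_plan h (bl : seq (seq {set V} * seq {set V})) acc : qalg R V (best R V) :=
  if bl is b :: bl' then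
    qbind (search h (sort supset b.1) (sort supset b.2) acc) (search_plan h bl')
  else Ret R V acc.

Lemma num_search_plan (g : {set V} -> R) h bl acc :
  (forall b, b \in bl -> size b.1 < 2 ^ h)%N ->
  (num_queries g (search_plan h bl acc) <= h * \sum_(b <- bl) block_cost b)%N.
Proof.
elim: bl acc => [//|b bl IH] acc hb; rewrite /= big_cons mulnDr.
apply: leq_trans (num_queries_bind (N := h * \sum_(b <- bl) block_cost b) _) _.
  by apply: always_true => acc'; apply: IH => b' b'l; apply: hb; rewrite inE b'l orbT.
rewrite leq_add2r; apply: leq_trans (num_search _ _ _ _) _; rewrite !size_sort //.
by apply: hb; rewrite inE eqxx.
Qed.

Lemma search_plan_spec h bl acc : (forall b, b \in bl -> size b.1 < 2 ^ h)%N ->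
  (forall b, b \in bl -> searchable b) ->
  always f (fun res : best R V => [/\ valid f acc -> valid f res, res.2 <= acc.2 &
    forall S, covers bl S -> res.2 <= f S]) (search_plan h bl acc).
Proof.
elim: bl acc => [|b bl IH] acc hb sb.
  by split=> // S [b [X [Y [//]]]].
have [ch1 ch2 dis] : searchable b by apply: sb; rewrite inE eqxx.
have srt s : is_chain s -> sorted supset (sort supset s).
  by move=> chs; apply: (sort_sorted_in (P := mem s)) => [X Y Xs Ys|]; [rewrite /supset orbC chs|apply/allP].
apply/always_bind; apply: always_impl (search_spec _ _ (srt _ ch1) (srt _ ch2) _)
  => [acc1 [v1 l1 c1]||]; last 2 first.
- by rewrite size_sort; apply: hb; rewrite inE eqxx.
- by move=> X Y; rewrite !mem_sort; apply: dis.
apply: always_impl (IH acc1 _ _) => [res [v2 l2 c2]||]; last 2 first.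
- by move=> b' b'l; apply: hb; rewrite inE b'l orbT.
- by move=> b' b'l; apply: sb; rewrite inE b'l orbT.
split=> [/v1/v2//||S [b' [X [Y [bb Xb Yb E]]]]]; first exact: le_trans l2 l1.
have -> : f S = f (X :|: Y) by case: E => ->; rewrite ?wcutC.
move: bb; rewrite inE => /orP[/eqP Eb|b'l]; last first.
  by apply: c2; exists b', X, Y; split=> //; left.
by apply: le_trans l2 _; apply: c1; rewrite mem_sort -Eb.
Qed.

End MongeSearch.

(** * Edge sampling, contraction and skeletons *)

Section Sampling.
Variables (R : realType) (V : finType) (r : V).
Implicit Types (X : {set V}) (s : seq V) (l : V -> V).

Lemma clamp_ge0 (x : R) : 0 <= Num.max 0 (Num.min x 1).
Proof. by rewrite le_max lexx. Qed.

Lemma clamp_le1 (x : R) : Num.max 0 (Num.min x 1) <= 1.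
Proof. by rewrite ge_max ler01 ge_min lexx orbT. Qed.

(** Makes [Flip] applicable to any quotient of answers; on the ratios that actually arise from
    nonnegative weights it is the identity. *)
Definition clamp01 (x : R) : {i01 R} := Itv01 (clamp_ge0 x) (clamp_le1 x).

Lemma clamp01E x : 0 <= x <= 1 -> (clamp01 x)%:num = x.
Proof. by move=> /andP[x0 x1] /=; rewrite min_l // max_r. Qed.

Lemma ratio01 (a b : R) : 0 <= a -> 0 <= b -> 0 < a + b -> 0 <= a / (a + b) <= 1.
Proof.
move=> a0 b0 pos; rewrite divr_ge0 ?(ltW pos) //=.
by rewrite ler_pdivrMr // mul1r lerDl.
Qed.

(** One descent serves both the random sampling and the deterministic search for a heavy vertex. *)
Definition branching := R -> R -> qalg R V V -> qalg R V V -> qalg R V V.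

Definition random_branch : branching := fun w1 ws a1 a2 => Flip (clamp01 (w1 / ws)) a1 a2.

Definition heavy_branch : branching := fun w1 ws a1 a2 => if ws <= w1 *+ 2 then a1 else a2.

(* Descends in [s] by halving; [ws] is the weight between [X] and [s], and [dX] the cut of [X]. *)
Fixpoint descend (br : branching) X dX h s ws : qalg R V V :=
  if h is h'.+1 then
    let s1 := take (2 ^ h') s in
    Query [set x in s1] (fun d1 => Query (X :|: [set x in s1]) (fun dU =>
      let w1 := (dX + d1 - dU) / 2 in
      br w1 ws (descend br X dX h' s1 w1) (descend br X dX h' (drop (2 ^ h') s) (ws - w1))))
  else Ret R V (head r s).

Lemma num_descend (f : {set V} -> R) br X dX h s ws :
  (forall w1 ws' a1 a2, num_queries f (br w1 ws' a1 a2) <= maxn (num_queries f a1) (num_queries f a2))%N ->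
  (num_queries f (descend br X dX h s ws) <= 2 * h)%N.
Proof.
move=> hbr; elim: h s ws => //= h IH s ws; rewrite mulnS !ltnS.
by apply: leq_trans (hbr _ _ _ _) _; rewrite geq_max !IH.
Qed.

Fixpoint choose_label (D : V -> R) s tot : qalg R V V :=
  if s is z :: s' then Flip (clamp01 (D z / tot)) (Ret R V z) (choose_label D s' (tot - D z))
  else Ret R V r.

Lemma num_choose_label f D s tot : num_queries f (choose_label D s tot) = 0%N.
Proof. by elim: s tot => //= z s IH tot; rewrite IH. Qed.

(** The first end is known only up to its class and is replaced by the label; saturated cuts cannot
    tell the difference. *)
Definition sample_edge L l (D : V -> R) : qalg R V (V * V) :=
  qbind (choose_label D (enum V) (\sum_z D z)) (fun z =>
  qbind (descend random_branch (fiber l z) (D z) L (enum (~: fiber l z)) (D z)) (fun b =>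
  Ret R V (z, b))).

Lemma num_sample_edge f L l D : (num_queries f (sample_edge L l D) <= 2 * L)%N.
Proof.
apply: leq_trans (num_queries_bind (N := 2 * L) _) _; last by rewrite num_choose_label.
apply: always_true => z; apply: leq_trans (num_queries_bind (N := 0) _) _; first exact: always_true.
by rewrite addn0 num_descend // => w1 ws a1 a2.
Qed.

Variable w : V -> V -> R.
Hypothesis wok : nonneg_symmetric w.
Local Notation f := (wcut w).

(** The weight between two disjoint sets is counted in both their cuts but not in the cut of the
    union. *)
Lemma split_weight X s1 : uniq s1 -> [disjoint X & [set x in s1]] ->
  (f X + f [set x in s1] - f (X :|: [set x in s1])) / 2 = \sum_(b <- s1) between w X [set b].
Proof.
move=> us dX; rewrite wcutU // (big_uniq _ us) /=.
rewrite (eq_bigl (mem [set x in s1])) => [|x]; last by rewrite /= inE.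
by rewrite -between_sum1r; lra.
Qed.

Lemma disjoint_take X s k : [disjoint X & [set x in s]] -> [disjoint X & [set x in take k s]].
Proof. by apply: disjointWr; apply/subsetP => x; rewrite !inE => /mem_take. Qed.

Lemma disjoint_drop X s k : [disjoint X & [set x in s]] -> [disjoint X & [set x in drop k s]].
Proof. by apply: disjointWr; apply/subsetP => x; rewrite !inE => /mem_drop. Qed.

(** Multiplying by the total weight keeps the identity meaningful for parts of weight 0, where no
    conditional distribution exists. *)
Lemma random_descend X h s (g : V -> R) : uniq s -> [disjoint X & [set x in s]] ->
  (size s <= 2 ^ h)%N ->
  (\sum_(b <- s) between w X [set b]) *
     expect f g (descend random_branch X (f X) h s (\sum_(b <- s) between w X [set b])) =
  \sum_(b <- s) between w X [set b] * g b.
Proof.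
elim: h s => [|h IH] s us dX hs.
  by case: s us dX hs => [|b [|]] //= _ _ _; rewrite ?big_nil ?mul0r // !big_seq1.
rewrite /= split_weight ?take_uniq ?disjoint_take //.
set s1 := take _ s; set s2 := drop _ s.
have Es : s = s1 ++ s2 by rewrite cat_take_drop.
have cat F : \sum_(b <- s) F b = \sum_(b <- s1) F b + \sum_(b <- s2) F b :> R.
  by rewrite {1}Es big_cat.
rewrite !cat; set w1 := \sum_(b <- s1) between w X [set b]; set w2 := \sum_(b <- s2) between w X [set b].
have -> : w1 + w2 - w1 = w2 by ring.
have p1 : 0 <= w1 by apply: sumr_ge0 => b _; apply: between_ge0.
have p2 : 0 <= w2 by apply: sumr_ge0 => b _; apply: between_ge0.
rewrite -IH ?take_uniq ?disjoint_take //; last by rewrite size_take; case: ifP => // /negbT; rewrite -leqNgt.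
rewrite -IH ?drop_uniq ?disjoint_drop //; last by rewrite size_drop leq_subLR addnn -mul2n -expnS.
rewrite -/w1 -/w2; have [E|ne] := eqVneq (w1 + w2) 0.
  have [-> ->] : w1 = 0 /\ w2 = 0 by lra.
  by rewrite addr0 !mul0r addr0.
have pos : 0 < w1 + w2 by rewrite lt_neqAle eq_sym ne addr_ge0.
rewrite clamp01E; first by field.
exact: ratio01.
Qed.

(** Each of the [h] halvings retains at least half of the weight. *)
Lemma heavy_descend X h s : uniq s -> [disjoint X & [set x in s]] ->
  (0 < size s <= 2 ^ h)%N ->
  always f (fun b => b \in s /\
      \sum_(b <- s) between w X [set b] <= 2 ^+ h * between w X [set b])
    (descend heavy_branch X (f X) h s (\sum_(b <- s) between w X [set b])).
Proof.
elim: h s => [|h IH] s us dX.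
  by case: s us dX => [|b [|]] //= _ _ _; rewrite inE eqxx big_seq1 mul1r lexx.
move=> /andP[s0 hs].
rewrite /= split_weight ?take_uniq ?disjoint_take //.
set s1 := take _ s; set s2 := drop _ s.
have Es : s = s1 ++ s2 by rewrite cat_take_drop.
rewrite [X in always _ _ X]/heavy_branch.
have -> : \sum_(b <- s) between w X [set b] =
    \sum_(b <- s1) between w X [set b] + \sum_(b <- s2) between w X [set b] by rewrite {1}Es big_cat.
set w1 := \sum_(b <- s1) between w X [set b]; set w2 := \sum_(b <- s2) between w X [set b].
have -> : w1 + w2 - w1 = w2 by ring.
case: ifPn => [le|]; last rewrite -ltNge => lt.
  apply: always_impl (IH s1 _ _ _); rewrite ?take_uniq ?disjoint_take //.
    move=> b [bs hb]; split; first by rewrite Es mem_cat bs.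
    by rewrite -/w1 in hb; rewrite exprS; lra.
  by rewrite size_take; case: ifP => [_|/negbT]; rewrite ?expn_gt0 ?leqnn // -leqNgt s0.
apply: always_impl (IH s2 _ _ _); rewrite ?drop_uniq ?disjoint_drop //.
  move=> b [bs hb]; split; first by rewrite Es mem_cat bs orbT.
  by rewrite -/w2 in hb; rewrite exprS; lra.
(* An empty second half has weight 0 and would have sent the descent into the first half. *)
rewrite size_drop leq_subLR addnn -mul2n -expnS hs andbT subn_gt0 ltnNge; apply: contraTN lt => le.
have -> : w2 = 0 by rewrite /w2 /s2 drop_oversize // big_nil.
have p1 : 0 <= w1 by apply: sumr_ge0 => b _; apply: between_ge0.
by rewrite -leNgt; lra.
Qed.

Lemma expect_choose_label D s g : (forall z, 0 <= D z) ->
  (\sum_(z <- s) D z) * expect f g (choose_label D s (\sum_(z <- s) D z)) = \sum_(z <- s) D z * g z.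
Proof.
move=> D0; elim: s => [|z s IH]; rewrite ?big_nil ?mul0r // !big_cons /=.
have -> : D z + \sum_(j <- s) D j - D z = \sum_(j <- s) D j by ring.
rewrite -IH; set e := expect _ _ _; set t := \sum_(j <- s) D j.
have t0 : 0 <= t by apply: sumr_ge0 => j _.
have [E|ne] := eqVneq (D z + t) 0.
  have [-> ->] : D z = 0 /\ t = 0 by have := D0 z; lra.
  by rewrite addr0 !mul0r addr0.
have pos : 0 < D z + t by rewrite lt_neqAle eq_sym ne addr_ge0.
rewrite clamp01E; first by field.
exact: ratio01.
Qed.

Lemma sum_sample l (g : V * V -> R) :
  \sum_z \sum_(b in ~: fiber l z) between w (fiber l z) [set b] * g (z, b) =
  \sum_a \sum_b w a b * (l a != l b)%:R * g (l a, b).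
Proof.
rewrite [RHS](partition_big l xpredT) //=; apply: eq_bigr => z _.
rewrite exchange_big /= [LHS]big_mkcond; apply: eq_bigr => b _.
rewrite !inE; have [lb|lb] := eqVneq (l b) z => /=.
  by rewrite big1 // => a /eqP la; rewrite la lb eqxx mulr0 mul0r.
rewrite between1r mulr_suml; apply: eq_big => [a|a]; first by rewrite inE.
by rewrite inE => /eqP la; rewrite la eq_sym lb mulr1.
Qed.

Lemma expect_sample_edge L l g : (#|V| < 2 ^ L)%N ->
  (\sum_z f (fiber l z)) * expect f g (sample_edge L l (fun z => f (fiber l z))) =
  \sum_a \sum_b w a b * (l a != l b)%:R * g (l a, b).
Proof.
move=> hL; rewrite -sum_sample /sample_edge expect_bind -[\sum_z f _]big_enum /=.
rewrite expect_choose_label; last by move=> z; apply: between_ge0.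
rewrite big_enum; apply: eq_bigr => z _ /=; rewrite expect_bind /= -[RHS]big_enum /=.
have fE : f (fiber l z) = \sum_(b <- enum (~: fiber l z)) between w (fiber l z) [set b].
  by rewrite big_enum /= -between_sum1r.
have := @random_descend (fiber l z) L (enum (~: fiber l z)) (fun b => g (z, b)).
rewrite -fE; apply; first exact: enum_uniq.
  rewrite disjoints_subset; apply/subsetP => x; rewrite !inE mem_enum !inE.
  by move=> ->.
by rewrite -cardE; apply: leq_trans (max_card _) (ltnW hL).
Qed.

Lemma sum_fiber_cut l : \sum_z f (fiber l z) = \sum_a \sum_b w a b * (l a != l b)%:R.
Proof.
under [RHS]eq_bigr => a _ do under eq_bigr => b _ do rewrite -[w a b * _]mulr1.
rewrite -(@sum_sample l (fun=> 1)); apply: eq_bigr => z _.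
under eq_bigr => b _ do rewrite mulr1.
by rewrite -between_sum1r.
Qed.

End Sampling.

(** * Random contraction *)

Section Contraction.
Variables (R : realType) (V : finType) (r : V) (L : nat) (T : R).
Implicit Types (l : V -> V) (D : V -> R) (S : {set V}).

(* A partition of the vertices is a map [l] sending each vertex to the representative
   of its class. *)
Definition idempotent_map l := forall x, l (l x) = l x.

Definition saturated l S := forall x, (l x \in S) = (x \in S).

Definition merge l z b : V -> V := fun x => if l x == l b then z else l x.

(** [D] stores the cut of every class. A merge changes only one surviving class, so one query
    updates it, and the absorbed label gets 0. *)
Fixpoint contract fuel l D : qalg R V ((V -> V) * (V -> R)) :=
  if fuel is k.+1 then
    if \sum_z D z <= T then Ret R V (l, D) else
    qbind (sample_edge r L l D) (fun e => let l' := merge l e.1 e.2 in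
    Query (fiber l' e.1) (fun d =>
    contract k l' (fun x => if x == e.1 then d else if x == l e.2 then 0 else D x)))
  else Ret R V (l, D).

Lemma num_contract (f : {set V} -> R) fuel l D :
  (num_queries f (contract fuel l D) <= fuel * (2 * L + 1))%N.
Proof.
elim: fuel l D => //= k IH l D; case: ifP => // _.
apply: leq_trans (num_queries_bind (N := 1 + k * (2 * L + 1)) _) _.
  by apply: always_true => e /=; rewrite add1n ltnS.
by have := num_sample_edge r f L l D; rewrite mulSn; lia.
Qed.

Lemma merge_idempotent l z b : idempotent_map l -> l z = z -> l b != z ->
  idempotent_map (merge l z b).
Proof.
move=> il lz bz x; rewrite /merge; have [E|ne] := eqVneq (l x) (l b).
  by rewrite lz eq_sym (negPf bz).
by rewrite il (negPf ne).
Qed.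

Lemma merge_card l z b : l z = z -> l b != z ->
  (#|merge l z b @: setT| < #|l @: setT|)%N.
Proof.
move=> lz bz; rewrite (cardsD1 (l b) (l @: setT)) imset_f // add1n ltnS.
apply/subset_leq_card/subsetP => _ /imsetP[x _ ->]; rewrite in_setD1 /merge.
have [_|ne] := eqVneq (l x) (l b); last by rewrite ne imset_f.
by rewrite eq_sym bz -{1}lz imset_f.
Qed.

Lemma merge_saturated l z b S : saturated l S -> (z \in S) = (b \in S) ->
  saturated (merge l z b) S.
Proof.
move=> sl zb x; rewrite /merge; case: eqP => [E|_]; last exact: sl.
by rewrite zb -(sl b) -E sl.
Qed.

Variable w : V -> V -> R.
Hypotheses (wok : nonneg_symmetric w) (card_lt_exp : (#|V| < 2 ^ L)%N).
Local Notation f := (wcut w).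

Lemma merge_fiber l z b : l z = z -> l b != z ->
  (fun x => if x == z then f (fiber (merge l z b) z) else
            if x == l b then 0 else f (fiber l x)) =
  (fun x => f (fiber (merge l z b) x)).
Proof.
move=> lz bz; apply: funext => x; case: eqP => [-> //|/eqP xz].
case: eqP => [->|/eqP xb].
  rewrite (_ : fiber _ _ = set0) ?wcut0 //; apply/setP=> y; rewrite !inE /merge.
  by case: ifPn => [_|/negPf //]; rewrite eq_sym (negPf bz).
congr (f _); apply/setP=> y; rewrite !inE /merge.
by case: ifP => // /eqP ->; rewrite eq_sym (negPf xb) eq_sym (negPf xz).
Qed.

Lemma one_class_cut l z : (#|l @: setT| <= 1)%N -> f (fiber l z) = 0.
Proof.
move=> l1; have lE x y : l x = l y by apply: (card_le1_eqP l1); apply: imset_f.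
have [->|[x xz]] := set_0Vmem (fiber l z); first exact: wcut0.
suff -> : fiber l z = setT by apply: wcutT.
by apply/setP=> y; rewrite !inE (lE y x); move: xz; rewrite inE.
Qed.

Variable S0 : {set V}.
Hypothesis T_gt0 : 0 < T.

(* While more than [T] is left, a sampled edge crosses [S0] with probability at most
   [2 * wcut w S0 / T]. *)
Lemma expect_contract fuel l (h : (V -> V) * (V -> R) -> R) p :
  0 <= p -> (forall st, h st <= 1) ->
  (forall l, idempotent_map l -> saturated l S0 -> \sum_z f (fiber l z) <= T ->
     h (l, fun z => f (fiber l z)) <= p) ->
  idempotent_map l -> saturated l S0 -> (#|l @: setT| <= fuel.+1)%N ->
  expect f h (contract fuel l (fun z => f (fiber l z))) <= fuel%:R * (2 * f S0 / T) + p.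
Proof.
move=> p0 h1 hp; have q0 : 0 <= 2 * f S0 / T.
  by rewrite divr_ge0 ?(ltW T_gt0) // mulr_ge0 // between_ge0.
elim: fuel l => [|k IH] l il sl lk.
  rewrite mul0r add0r /=; apply: hp => //.
  by rewrite big1 ?ltW // => z _; apply: one_class_cut.
rewrite /=; case: ifPn => [le|]; first by apply: le_trans (hp _ il sl le) _; rewrite lerDr mulr_ge0.
rewrite -ltNge => gt; have W0 := lt_trans T_gt0 gt; set W := \sum_z _ in gt W0 *.
pose g (e : V * V) := expect f h (contract k (merge l e.1 e.2)
  (fun x => if x == e.1 then f (fiber (merge l e.1 e.2) e.1)
            else if x == l e.2 then 0 else f (fiber l x))).
rewrite expect_bind -(ler_pM2l W0).
rewrite -[leLHS]/(W * expect f g (sample_edge r L l (fun z => f (fiber l z)))).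
rewrite expect_sample_edge //.
(* A sampled edge crossing [S0] is charged the full 1; otherwise [S0] stays saturated and the
   induction applies. *)
have gE a b : l a != l b -> g (l a, b) <= ((a \in S0) != (b \in S0))%:R + (k%:R * (2 * f S0 / T) + p).
  move=> ab; rewrite /g /= merge_fiber //; last by rewrite eq_sym.
  have [E|ne] /= := eqVneq (a \in S0) (b \in S0).
    rewrite add0r; apply: IH.
    - by apply: merge_idempotent; rewrite // eq_sym.
    - by apply: merge_saturated; rewrite // sl.
    - by rewrite -ltnS; apply: leq_trans lk; apply: merge_card; rewrite // eq_sym.
  apply: le_trans (_ : 1 <= _); last by rewrite lerDl addr_ge0 // mulr_ge0.
  exact/expect_le_cst/always_true.
have le1 : \sum_a \sum_b w a b * (l a != l b)%:R * g (l a, b) <=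
   \sum_a \sum_b (w a b * ((a \in S0) != (b \in S0))%:R +
                  w a b * (l a != l b)%:R * (k%:R * (2 * f S0 / T) + p)).
  have [_ w0] := wok; apply: ler_sum => a _; apply: ler_sum => b _.
  have [E|ab] := eqVneq (l a) (l b); first by rewrite mulr0 !mul0r addr0 mulr_ge0.
  by rewrite !mulr1 -mulrDr; apply: ler_wpM2l => //; apply: gE.
apply: le_trans le1 _.
under eq_bigr => a _ do rewrite big_split /= -mulr_suml.
rewrite big_split /= -mulr_suml sum_sep_wcut // -sum_fiber_cut // -/W.
have q1 : 2 * f S0 <= W * (2 * f S0 / T).
  by rewrite mulrA ler_pdivlMr // mulrC ler_wpM2r // ?mulr_ge0 ?between_ge0 // ltW.
by rewrite -[f S0 *+ 2]mulr_natl mulrS; move: q1; set q := (2 * f S0 / T); lra.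
Qed.

End Contraction.

Section IidSamples.
Variables (R : realType) (V : finType) (r : V) (L : nat).

Fixpoint samples M (l : V -> V) (D : V -> R) : qalg R V (seq (V * V)) :=
  if M is M'.+1 then
    qbind (sample_edge r L l D) (fun e => qbind (samples M' l D) (fun s => Ret R V (e :: s)))
  else Ret R V [::].

Lemma num_samples (f : {set V} -> R) M l D : (num_queries f (samples M l D) <= M * (2 * L))%N.
Proof.
elim: M => //= M IH; rewrite mulSn.
apply: leq_trans (num_queries_bind (N := M * (2 * L)) _) _; last by rewrite leq_add2r num_sample_edge.
apply: always_true => e; apply: leq_trans (num_queries_bind (N := 0) _) _; first exact: always_true.
by rewrite addn0.
Qed.

Lemma expect_samples_prod f M l D (phi : V * V -> R) :
  expect f (fun s => \prod_(e <- s) phi e) (samples M l D) =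
  expect f phi (sample_edge r L l D) ^+ M.
Proof.
elim: M => [|M IH] /=; first by rewrite big_nil expr0.
rewrite expect_bind exprS -IH mulrC -expectZ; apply: eq_expect => e.
rewrite expect_bind mulrC -expectZ; apply: eq_expect => s /=.
by rewrite big_cons.
Qed.

Lemma expect_samples_sum f M l D (phi : V * V -> R) :
  expect f (fun s => \sum_(e <- s) phi e) (samples M l D) =
  M%:R * expect f phi (sample_edge r L l D).
Proof.
elim: M => [|M IH] /=; first by rewrite big_nil mul0r.
rewrite expect_bind mulrS mulrDl mul1r -IH.
rewrite -[X in _ = _ + X](expect_cst f _ (sample_edge r L l D)) -expectD.
apply: eq_expect => e; rewrite expect_bind.
rewrite -[X in _ = X + _](expect_cst f _ (samples M l D)) -expectD.
by apply: eq_expect => s /=; rewrite big_cons.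
Qed.

End IidSamples.

(** * The sampled skeleton *)

Section Skeleton.
Variables (R : realType) (V : finType) (r : V) (L : nat).
Implicit Types (l : V -> V) (S : {set V}) (s : seq (V * V)) (e : V * V).

Definition separates S e := (e.1 \in S) != (e.2 \in S).

Definition crossings S s : R := \sum_(e <- s) (separates S e)%:R.

(* Vertices of one class are joined by weight [M], more than any cut of interest. *)
Definition skeleton (M : nat) l s (a b : V) : R :=
  \sum_(e <- s) ((e == (a, b))%:R + (e == (b, a))%:R) + M%:R * (l a == l b)%:R.

Lemma skeleton_ok M l s : nonneg_symmetric (skeleton M l s).
Proof.
split=> a b; rewrite /skeleton.
  by rewrite eq_sym; congr (_ + _); apply: eq_bigr => e _; rewrite addrC.
by rewrite addr_ge0 ?mulr_ge0 // sumr_ge0 // => e _; rewrite addr_ge0.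
Qed.

Lemma sum_pair_eq (x y : V) (A B : {set V}) :
  \sum_(a in A) \sum_(b in B) ((x, y) == (a, b))%:R = ((x \in A) && (y \in B))%:R :> R.
Proof.
rewrite pair_big /=.
have [xyAB|xyAB] := boolP ((x \in A) && (y \in B)).
  rewrite (bigD1 (x, y)) //= eqxx big1 ?addr0 // => -[a b] /andP[_].
  by rewrite eq_sym => /negPf ->.
rewrite big1 // => -[a b] ab; case: eqP => // E.
by case: E => Ex Ey; move: xyAB; rewrite Ex Ey; move: ab => /= ->.
Qed.

Lemma skeleton_cut M l s S : saturated l S -> wcut (skeleton M l s) S = crossings S s.
Proof.
move=> sl; rewrite /wcut /between /crossings /skeleton.
under eq_bigr => a aS do (under eq_bigr => b bS do
  (rewrite (_ : (l a == l b) = false); last by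
     (apply/negP => /eqP E; move: bS; rewrite inE -(sl b) -E sl aS)); 
  under eq_bigr => b _ do rewrite mulr0 addr0).
under eq_bigr => a _ do rewrite exchange_big /=.
rewrite exchange_big; apply: eq_bigr => -[x y] _ /=.
under eq_bigr => a _ do rewrite big_split /=.
rewrite big_split /= sum_pair_eq exchange_big /=.
rewrite (eq_bigr (fun j => \sum_(i in S) ((x, y) == (j, i))%:R)) //.
rewrite sum_pair_eq !inE /separates /=.
by case: (x \in S); case: (y \in S); rewrite /= ?addr0 ?add0r.
Qed.

Lemma skeleton_cut_unsaturated M l s S : idempotent_map l -> ~ saturated l S ->
  M%:R <= wcut (skeleton M l s) S.
Proof.
move=> il nsl.
have le a b : a \in S -> b \notin S -> l a = l b -> M%:R <= wcut (skeleton M l s) S.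
  move=> aS bS E; apply: le_trans (_ : between (skeleton M l s) [set a] [set b] <= _).
    rewrite /between !big_set1 /skeleton E eqxx mulr1 lerDr.
    by apply: sumr_ge0 => e _; rewrite addr_ge0.
  by apply: between_le; [exact: skeleton_ok|rewrite sub1set|rewrite sub1set inE].
have /existsNP[x nx] := nsl.
have [xS|xS] := boolP (x \in S); have [lxS|lxS] := boolP (l x \in S).
- by case: nx; rewrite xS lxS.
- exact: le xS lxS (esym (il x)).
- exact: le lxS xS (il x).
- by case: nx; rewrite (negPf xS) (negPf lxS).
Qed.

Variable w : V -> V -> R.
Hypotheses (wok : nonneg_symmetric w) (card_lt_exp : (#|V| < 2 ^ L)%N).
Local Notation f := (wcut w).
Variables (l : V -> V) (S0 : {set V}) (M : nat).
Hypotheses (il : idempotent_map l) (S0l : saturated l S0).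
Hypotheses (c_gt0 : 0 < f S0) (minS0 : forall S, proper_cut S -> f S0 <= f S).
Hypothesis M_gt0 : (0 < M)%N.

Definition faithful_skeleton (t : R) s :=
  (forall S, proper_cut S -> 16 / 17 * t <= wcut (skeleton M l s) S) /\
  wcut (skeleton M l s) S0 <= 18 / 17 * t.

(** The exponential dominates the indicator of a light cut and factors over independent samples.
    Unsaturated sets get 0, as the weight [M] inside classes never lets them be light. *)
Definition low_weight (t : R) S s := if `[< saturated l S >] then
  expR (17^-1 * (16 / 17 * t - crossings S s)) else 0.

(** Markov's bound for [S0] plus a union bound over light cuts, both in pointwise form; each cut is
    represented by its side avoiding [r]. *)
Lemma unfaithful_le (t : R) s : 0 < t -> t <= M%:R ->
  (~~ `[< faithful_skeleton t s >])%:R <= 17 / (18 * t) * crossings S0 s +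
  \sum_(S | proper_cut S && (r \notin S)) low_weight t S s.
Proof.
move=> t0 tM.
have ind0 S : 0 <= low_weight t S s by rewrite /low_weight; case: ifP => // _; apply: expR_ge0.
have s0 : 0 <= \sum_(S | proper_cut S && (r \notin S)) low_weight t S s by apply: sumr_ge0 => S _.
have c0 : 0 <= crossings S0 s by apply: sumr_ge0.
have t18 : 0 < 18 * t by rewrite mulr_gt0.
have k0 : 0 <= 17 / (18 * t) by rewrite divr_ge0 // ltW.
have kc0 := mulr_ge0 k0 c0.
case: asboolP => [_|nf] /=; first by rewrite addr_ge0.
have [le|gt] := leP (crossings S0 s) (18 / 17 * t); last first.
  apply: le_trans (_ : 17 / (18 * t) * crossings S0 s <= _); last by rewrite lerDl.
  by rewrite mulrAC ler_pdivlMr //; lra.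
apply: le_trans (_ : \sum_(S | proper_cut S && (r \notin S)) low_weight t S s <= _);
  last by rewrite lerDr.
have [S [pS rS lt]] : exists S, [/\ proper_cut S, r \notin S &
    wcut (skeleton M l s) S < 16 / 17 * t].
  apply: contrapT => h; apply: nf; split; last by rewrite skeleton_cut.
  move=> S pS; rewrite leNgt; apply/negP => lt; apply: h.
  have [rS|rS] := boolP (r \in S); last by exists S.
  by exists (~: S); rewrite proper_cutC inE rS wcutC //; apply: skeleton_ok.
rewrite (bigD1 S) /= ?pS ?rS //.
apply: le_trans (_ : low_weight t S s <= _); last by rewrite lerDl; apply: sumr_ge0.
have [sl|nsl] := pselect (saturated l S); last first.
  by have := skeleton_cut_unsaturated M s il nsl; lra.
rewrite /low_weight (asboolT sl) -[leLHS]expR0 ler_expR -(skeleton_cut M s sl).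
by rewrite mulr_ge0 // subr_ge0 ltW.
Qed.

Definition total : R := \sum_z f (fiber l z).

Lemma sum_cross_separates S : saturated l S ->
  \sum_a \sum_b w a b * (l a != l b)%:R * (separates S (l a, b))%:R = f S *+ 2.
Proof.
move=> sl; rewrite -sum_sep_wcut //; apply: eq_bigr => a _; apply: eq_bigr => b _.
rewrite /separates /= sl; have [E|_] := eqVneq (l a) (l b); last by rewrite mulr1.
by rewrite -(sl a) E sl eqxx !mulr0.
Qed.

Lemma total_ge S : saturated l S -> f S *+ 2 <= total.
Proof.
move=> /sum_cross_separates <-; rewrite /total sum_fiber_cut //; have [_ w0] := wok.
by apply: ler_sum => a _; apply: ler_sum => b _; rewrite ler_piMr // ?mulr_ge0 // lern1 leq_b1.
Qed.

Lemma total_gt0 : 0 < total.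
Proof. by apply: lt_le_trans (total_ge S0l); rewrite mulr2n addr_gt0. Qed.

(* The expected number of samples crossing [S0]. *)
Definition rho : R := M%:R * (2 * f S0 / total).

Lemma rho_gt0 : 0 < rho.
Proof. by rewrite /rho !mulr_gt0 ?ltr0n // invr_gt0 total_gt0. Qed.

Lemma rho_le : rho <= M%:R.
Proof.
rewrite /rho ler_piMr // ler_pdivrMr ?total_gt0 // mul1r mulr_natl.
exact: total_ge.
Qed.

Local Notation sampled := (samples r L M l (fun z => f (fiber l z))).

Lemma expect_separates S : saturated l S ->
  expect f (fun e => (separates S e)%:R) (sample_edge r L l (fun z => f (fiber l z))) =
  2 * f S / total.
Proof.
move=> sl; apply: (mulfI (lt0r_neq0 total_gt0)); rewrite /total expect_sample_edge //.
rewrite sum_cross_separates // -/total mulrCA divff ?(lt0r_neq0 total_gt0) //.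
by rewrite mulr1 mulr_natl.
Qed.

Lemma expect_crossings : expect f (crossings S0) sampled = rho.
Proof. by rewrite expect_samples_sum expect_separates. Qed.

Lemma expect_exp_separates S (x : R) : saturated l S ->
  expect f (fun e => expR (- (x * (separates S e)%:R)))
    (sample_edge r L l (fun z => f (fiber l z))) =
  1 - (1 - expR (- x)) * (2 * f S / total).
Proof.
move=> sl; rewrite -expect_separates // -expectZ -[X in _ = X - _](expect_cst f 1
  (sample_edge r L l (fun z => f (fiber l z)))).
rewrite -[X in _ = _ - X]mul1r -mulNr -expectZ -expectD; apply: eq_expect => e.
by case: (separates S e); rewrite /= ?mulr1 ?mulr0 ?oppr0 ?expR0; ring.
Qed.

Lemma expRN17_le : expR (- 17^-1) <= 17 / 18 :> R.
Proof.
rewrite expRN invf_ple ?posrE ?expR_gt0 ?divr_gt0 //.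
by apply: le_trans (expR_ge1Dx _); lra.
Qed.

(* Chernoff's lower tail at deviation 1/17; weakening [1 - exp (- 1/17)] to [1/18]
   costs only the constant factor. *)
Lemma lower_tail S : proper_cut S -> saturated l S ->
  expect f (fun s => expR (17^-1 * (16 / 17 * rho - crossings S s))) sampled <=
  expR (- (rho / (17 ^+ 2 * 18) * (f S / f S0))).
Proof.
move=> pS sl.
have E s : expR (17^-1 * (16 / 17 * rho - crossings S s)) =
    expR (16 / 289 * rho) * \prod_(e <- s) expR (- (17^-1 * (separates S e)%:R)).
  by rewrite -expR_sum -expRD sumrN -mulr_sumr /crossings; congr expR; field.
rewrite (eq_expect _ _ E) expectZ expect_samples_prod expect_exp_separates //.
set p := 2 * f S / total; have p0 : 0 <= p.
  by rewrite divr_ge0 ?(ltW total_gt0) // mulr_ge0 // between_ge0.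
have p1 : p <= 1 by rewrite ler_pdivrMr ?total_gt0 // mul1r mulr_natl total_ge.
have e17 := expRN17_le; have e0 := expR_gt0 (- 17^-1 : R).
apply: le_trans (_ : expR (16 / 289 * rho) * expR (- (p / 18)) ^+ M <= _).
  rewrite ler_wpM2l ?expR_ge0 // lerXn2r ?nnegrE ?expR_ge0 //; first by nra.
  by apply: le_trans (expR_ge1Dx _); nra.
rewrite -expRM_natr -expRD ler_expR.
have -> : - (p / 18) * M%:R = - (rho * (f S / f S0) / 18).
  by rewrite /p /rho; field; rewrite !gt_eqF // total_gt0.
have a1 : 1 <= f S / f S0 by rewrite ler_pdivlMr // mul1r minS0.
have := rho_gt0; move: a1; set a := f S / f S0; nra.
Qed.

(** The 17/18 is Markov's inequality at 18/17 times the mean. For the rest, [sum_exp_cut_le] is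
    applied with [theta = rho / (17 ^+ 2 * 18)], and its [theta / 2] turns 18 into 36. *)
Lemma unfaithful_skeleton : expR (- (rho / (17 ^+ 2 * 36))) <= (100 * #|V|%:R)^-1 ->
  expect f (fun s => (~~ `[< faithful_skeleton rho s >])%:R) sampled <= 17 / 18 + 99^-1.
Proof.
move=> hx.
have r0 := rho_gt0.
apply: le_trans (_ : expect f (fun s => 17 / (18 * rho) * crossings S0 s +
  \sum_(S | proper_cut S && (r \notin S)) low_weight rho S s) sampled <= _).
  by apply/expect_le/always_true => s; apply: unfaithful_le => //; apply: rho_le.
rewrite expectD expectZ expect_crossings expect_sum; apply: lerD.
  have cancel (x : R) : 0 < x -> 17 / (18 * x) * x = 17 / 18.
    by move=> x0; field; rewrite gt_eqF.
  by rewrite cancel.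
apply: le_trans (_ : \sum_(S | proper_cut S && (r \notin S))
    expR (- (rho / (17 ^+ 2 * 18) * (f S / f S0))) <= _).
  apply: ler_sum => S /andP[pS rS]; have [sl|nsl] := pselect (saturated l S).
    by rewrite /low_weight (asboolT sl); apply: lower_tail.
  rewrite /low_weight; case: asboolP => // _; rewrite expect_cst; exact: expR_ge0.
apply: le_trans (sum_exp_cut_le r wok _ minS0 c_gt0 _) _;
  [exact: ltW|by rewrite divr_ge0 ?(ltW r0) // mulr_ge0 // exprn_ge0|].
have half (x : R) : x / (17 ^+ 2 * 18) / 2 = x / (17 ^+ 2 * 36) by field.
rewrite half.
have V0 : (0 < #|V|)%N by apply/card_gt0P; exists r.
(* [(1 + 1 / (100 n)) ^ n <= exp (1/100) <= 100/99] leaves 1/99 after subtracting 1. *)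
have le1 : (1 + expR (- (rho / (17 ^+ 2 * 36)))) ^+ #|V| <= expR (100^-1).
  apply: le_trans (_ : expR ((100 * #|V|%:R)^-1) ^+ #|V| <= _).
    rewrite lerXn2r ?nnegrE ?expR_ge0 ?addr_ge0 ?expR_ge0 //.
    by apply: le_trans (expR_ge1Dx _); rewrite lerD2l.
  rewrite -expRM_natr le_eqVlt; apply/orP; left; apply/eqP; congr expR.
  by field; rewrite pnatr_eq0 -lt0n.
have le2 : expR (100^-1) <= 100 / 99 :> R.
  rewrite -[100^-1]opprK expRN invf_ple ?posrE ?expR_gt0 ?divr_gt0 //.
  by apply: le_trans (expR_ge1Dx _); lra.
by rewrite lerBlDr; apply: le_trans le1 (le_trans le2 _); lra.
Qed.

End Skeleton.

(** * The algorithm *)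

Section Trial.
Variables (R : realType) (V : finType) (r : V) (L : nat).
Hypotheses (card_gt1 : (1 < #|V|)%N) (card_lt_exp : (#|V| < 2 ^ L)%N).
Implicit Types (l : V -> V) (S : {set V}) (acc res : best R V) (H : V -> V -> R).

Definition near_min H S := exists2 tau,
  0 < tau /\ (forall S', proper_cut S' -> tau <= wcut H S') &
  proper_cut S /\ 8 * wcut H S <= 9 * tau.

Definition plan_size := (150 * L ^ 3 * #|V|)%N.

(** Planning makes no queries, so any choice of plan will do; the empty default keeps the size bound
    for every [H]. *)
Definition plan_of H : seq (seq {set V} * seq {set V}) :=
  if pselect (exists bl, plan bl plan_size (near_min H)) is left e
  then projT1 (cid e) else [::].

Lemma plan_ofP H :
  (forall b, b \in plan_of H -> searchable b) /\
  (\sum_(b <- plan_of H) block_cost b <= plan_size)%N.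
Proof.
rewrite /plan_of; case: pselect => [e|_]; last by rewrite big_nil.
by case: (cid e) => bl [].
Qed.

Lemma plan_of_covers H S : nonneg_symmetric H -> near_min H S -> covers (plan_of H) S.
Proof.
move=> Hok; rewrite /plan_of; case: pselect => [e|[]]; last exact: plan_exists.
by have [_ _] := projT2 (cid e); apply.
Qed.

(** A block has at most [plan_size] rows, and [150 < 2 ^ 8], [L ^ 3 <= 2 ^ (3 * L)],
    [#|V| < 2 ^ L]. *)
Definition search_depth := (8 + 4 * L)%N.

Lemma size_lt_depth H b : b \in plan_of H -> (size b.1 < 2 ^ search_depth)%N.
Proof.
move=> bH; have [_ le] := plan_ofP H.
apply: leq_ltn_trans (_ : (plan_size < _)%N); last first.
  rewrite /plan_size /search_depth expnD mulnC.
  have L3 : (L ^ 3 <= 2 ^ (3 * L))%N by rewrite mulnC expnM leq_exp2r // ltnW // ltn_expl.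
  have -> : (2 ^ 8 * 2 ^ (4 * L) = (2 ^ L) * (256 * 2 ^ (3 * L)))%N.
    rewrite (_ : 4 * L = L + 3 * L)%N; last by lia.
    by rewrite expnD mulnCA.
  apply: ltn_mul => //; apply: leq_ltn_trans (_ : (150 * 2 ^ (3 * L) < _)%N).
    by rewrite leq_mul2l L3 orbT.
  by rewrite ltn_pmul2r ?expn_gt0.
apply: leq_trans le; rewrite (big_rem b) //= /block_cost -addnA leq_addr //.
Qed.

(* 200 is the contraction threshold factor; the last factor makes the expected number of
   samples crossing a minimum cut large enough for [unfaithful_skeleton]. *)
Definition sample_size := (200 * #|V| * (17 ^ 2 * 36 * (7 + L)))%N.

Definition threshold (guess : R) : R := 2 * 200%:R * guess * #|V|%:R.

Definition trial (guess : R) acc : qalg R V (best R V) :=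
  qbind (query_all R [seq [set z] | z <- enum V]) (fun ds =>
  qbind (contract r L (threshold guess) #|V| id (fun z => ds`_(index z (enum V)))) (fun st =>
  qbind (samples r L sample_size st.1 st.2) (fun s =>
  search_plan search_depth (plan_of (skeleton R sample_size st.1 s)) acc))).

Definition trial_cost :=
  (#|V| + (#|V| * (2 * L + 1) + (sample_size * (2 * L) + search_depth * plan_size)))%N.

Lemma num_trial (g : {set V} -> R) guess acc : (num_queries g (trial guess acc) <= trial_cost)%N.
Proof.
apply: leq_trans (num_queries_bind
  (N := #|V| * (2 * L + 1) + (sample_size * (2 * L) + search_depth * plan_size)) _) _; last first.
  by rewrite num_query_all size_map -cardE.
apply: always_true => ds; apply: leq_trans (num_queries_bind
  (N := sample_size * (2 * L) + search_depth * plan_size) _) _; last first.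
  by rewrite leq_add2r num_contract.
apply: always_true => st; apply: leq_trans (num_queries_bind
  (N := search_depth * plan_size) _) _; last by rewrite leq_add2r num_samples.
apply: always_true => s; apply: leq_trans (num_search_plan _ _ _) _.
  by move=> b; apply: size_lt_depth.
by rewrite leq_mul2l; have [_ ->] := plan_ofP (skeleton R sample_size st.1 s); rewrite orbT.
Qed.

Variable w : V -> V -> R.
Hypothesis wok : nonneg_symmetric w.
Local Notation f := (wcut w).

(** Soundness for every guess and every coin outcome, since each recorded value is an exact answer
    for a proper cut. *)
Lemma trial_improves guess acc :
  always f (fun res => (valid f acc -> valid f res) /\ res.2 <= acc.2) (trial guess acc).
Proof.
apply/always_bind/always_true => ds; apply/always_bind/always_true => st.
apply/always_bind/always_true => s; apply: always_impl (search_plan_spec wok _ _ _).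
- by move=> res [].
- by move=> b; apply: size_lt_depth.
- by have [] := plan_ofP (skeleton R sample_size st.1 s).
Qed.

Lemma expect_query_all (h : seq R -> R) (s : seq {set V}) :
  expect f h (query_all R s) = h [seq f X | X <- s].
Proof. by elim: s h => //= X s IH h; rewrite expect_bind /= IH. Qed.

Lemma exp2n_le_expR n : (2 ^ n)%:R <= expR n%:R :> R.
Proof.
rewrite natrX -[X in expR X]mulr1 expRM_natl lerXn2r ?nnegrE ?expR_ge0 //.
exact: expR_ge1Dx.
Qed.

Variable S0 : {set V}.
Hypotheses (pS0 : proper_cut S0) (minS0 : forall S, proper_cut S -> f S0 <= f S).
Hypothesis c_gt0 : 0 < f S0.

Definition misses res : R := (f S0 < res.2)%R%:R.

(** [2 * guess / threshold guess] is [1 / (200 * #|V|)] and cancels the leading factors of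
    [sample_size]. *)
Lemma rho_ge guess l : 0 < guess -> guess <= f S0 -> saturated l S0 ->
  total w l <= threshold guess -> (17 ^ 2 * 36 * (7 + L))%:R <= rho w l S0 sample_size.
Proof.
move=> g0 gc sl tT; have t0 := total_gt0 wok sl c_gt0.
have V0 : 0 < #|V|%:R :> R by rewrite ltr0n ltnW.
have T0 : 0 < threshold guess by apply: lt_le_trans tT.
set N := (17 ^ 2 * 36 * (7 + L))%N.
apply: le_trans (_ : sample_size%:R * (2 * guess / threshold guess) <= _).
  rewrite le_eqVlt; apply/orP; left; apply/eqP.
  rewrite /threshold /sample_size -/N !natrM; field.
  by rewrite !gt_eqF.
rewrite /rho ler_wpM2l // ler_pM // ?mulr_ge0 ?invr_ge0 ?(ltW g0) ?(ltW T0) //.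
  by rewrite ler_pM2l.
by rewrite lef_pV2 ?posrE.
Qed.

(** The 7 comes from [100 <= 2 ^ 7]; the [L] pays for [#|V|]. *)
Lemma expR_sample_le x : (17 ^ 2 * 36 * (7 + L))%:R <= x ->
  expR (- (x / (17 ^+ 2 * 36))) <= (100 * #|V|%:R)^-1 :> R.
Proof.
move=> hx; have V0 : 0 < #|V|%:R :> R by rewrite ltr0n ltnW.
rewrite expRN lef_pV2 ?posrE ?expR_gt0 ?mulr_gt0 //.
apply: le_trans (_ : expR (7 + L)%:R <= _); last first.
  rewrite ler_expR ler_pdivlMr; last by rewrite mulr_gt0 // exprn_gt0.
  by apply: le_trans hx; rewrite [leRHS]natrM mulrC natrM natrX lexx.
apply: le_trans (exp2n_le_expR _); rewrite -natrM ler_nat expnD.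
by apply: leq_mul; rewrite // ltnW.
Qed.

Lemma skeleton_search_misses guess l acc :
  0 < guess -> guess <= f S0 -> idempotent_map l -> saturated l S0 ->
  total w l <= threshold guess ->
  expect f misses (qbind (samples r L sample_size l (fun z => f (fiber l z))) (fun s =>
    search_plan search_depth (plan_of (skeleton R sample_size l s)) acc)) <= 17 / 18 + 99^-1.
Proof.
move=> g0 gc il sl tT; have hrho := rho_ge g0 gc sl tT.
have M0 : (0 < sample_size)%N by rewrite /sample_size !muln_gt0 (ltnW card_gt1).
have r0 := rho_gt0 wok sl c_gt0 M0; set t := rho _ _ _ _ in hrho r0.
apply: le_trans (unfaithful_skeleton r wok card_lt_exp il sl c_gt0 minS0 M0 (expR_sample_le hrho)).
rewrite expect_bind -/t; apply/expect_le/always_true => s.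
case: asboolP => [[mc c0]|_] /=; last first.
  by apply/expect_le_cst/always_true => res; rewrite lern1 leq_b1.
apply: expect_le_cst; apply: always_impl (search_plan_spec wok (h := search_depth) acc _ _); last 2 first.
- by move=> b; apply: size_lt_depth.
- by have [] := plan_ofP (skeleton R sample_size l s).
move=> res [_ _ cov]; rewrite /misses ltNge cov //.
apply: plan_of_covers; first exact: skeleton_ok.
(* Here [8 * 18 = 9 * 16]. *)
by exists (16 / 17 * t); split => //; [rewrite mulr_gt0|move: c0; lra].
Qed.

(* Failure: 1/100 for the contraction, 17/18 + 1/99 for the skeleton. *)
Lemma trial_misses guess acc : guess <= f S0 -> f S0 <= 2 * guess ->
  expect f misses (trial guess acc) <= 29 / 30.
Proof.
move=> gc cg; have g0 : 0 < guess by have := c_gt0; lra.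
have V0 : 0 < #|V|%:R :> R by rewrite ltr0n ltnW.
rewrite /trial expect_bind expect_query_all.
rewrite (_ : (fun z => _) = (fun z => f (fiber id z))); last first.
  apply: funext => z; rewrite -map_comp (nth_map z) ?index_mem ?mem_enum //= nth_index ?mem_enum //.
  by congr (f _); apply/setP => x; rewrite !inE.
have T0 : 0 < threshold guess by rewrite /threshold !mulr_gt0.
rewrite expect_bind; apply: le_trans (expect_contract r wok card_lt_exp (S0 := S0)
  (p := 17 / 18 + 99^-1) T0 _ _ _ _ _ _) _.
- by rewrite addr_ge0 // divr_ge0.
- by move=> st; apply/expect_le_cst/always_true => res; rewrite lern1 leq_b1.
- by move=> l il sl tT; exact: (skeleton_search_misses acc g0 gc il sl tT).
- by [].
- by [].
- by rewrite imset_id cardsT.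
have -> : #|V|%:R * (2 * f S0 / threshold guess) = f S0 / (200%:R * guess).
  by rewrite /threshold; field; rewrite !gt_eqF.
have : f S0 / (200%:R * guess) <= 100^-1.
  by rewrite ler_pdivrMr ?mulr_gt0 //; lra.
by lra.
Qed.

End Trial.

(** * A coarse deterministic estimate of the minimum cut *)

Section Prim.
Variables (R : realType) (V : finType) (r : V) (L : nat).
Hypothesis card_lt_exp : (#|V| < 2 ^ L)%N.
Implicit Types (X S : {set V}) (acc res : best R V).

Fixpoint prim fuel X acc : qalg R V (best R V) :=
  if fuel is k.+1 then
    if X == setT then Ret R V acc else
    Query X (fun d => qbind (descend r (heavy_branch (V := V)) X d L (enum (~: X)) d) (fun v =>
    prim k (v |: X) (improve acc X d)))
  else Ret R V acc.

Lemma num_prim (g : {set V} -> R) fuel X acc :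
  (num_queries g (prim fuel X acc) <= fuel * (2 * L + 1))%N.
Proof.
elim: fuel X acc => //= k IH X acc; case: ifP => // _ /=.
apply: leq_ltn_trans (num_queries_bind (N := k * (2 * L + 1)) _) _.
  exact: always_true.
have hd : (num_queries g (descend r (heavy_branch (V := V)) X (g X) L (enum (~: X)) (g X)) <= 2 * L)%N.
  apply: num_descend => w1 ws a1 a2.
  by rewrite /heavy_branch; case: ifP => _; rewrite leq_max leqnn ?orbT.
by rewrite mulSn; lia.
Qed.

Variable w : V -> V -> R.
Hypothesis wok : nonneg_symmetric w.
Local Notation f := (wcut w).

(* [X] grows along nearly heaviest edges, so when it first leaves a cut [S] the vertex
   added is joined to [X] by at least the fraction [2^-L] of the cut of [X]. *)
Lemma prim_spec fuel X acc : X != set0 ->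
  always f (fun res => [/\ valid f acc -> valid f res, res.2 <= acc.2 &
    forall S, X \subset S -> S != setT -> (#|V| < fuel + #|X|)%N -> res.2 <= 2 ^+ L * f S])
  (prim fuel X acc).
Proof.
elim: fuel X acc => [|k IH] X acc X0.
  by split=> // S _ _; rewrite add0n ltnNge max_card.
rewrite /=; case: eqP => [->|/eqP XT].
  by split=> // S; rewrite subTset => /eqP -> /eqP.
rewrite /=; apply/always_bind.
have sC : (\sum_(b <- enum (~: X)) between w X [set b]) = f X by rewrite big_enum /= -between_sum1r.
have := @heavy_descend R V r w wok X L (enum (~: X)); rewrite sC => hd.
apply: always_impl (hd _ _ _); last 3 first.
- exact: enum_uniq.
- by rewrite disjoint_sym disjoints_subset; apply/subsetP => x; rewrite !inE mem_enum !inE.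
- rewrite -cardE; apply/andP; split; last by apply: leq_trans (max_card _) (ltnW card_lt_exp).
  by rewrite card_gt0; apply: contraNneq XT => E; rewrite -[X]setCK E setC0.
move=> v [vX hv]; rewrite mem_enum inE in vX.
have [li li'] := improve_le acc X (f X).
have pX : proper_cut X by rewrite proper_cutE X0.
apply: always_impl (IH (v |: X) (improve acc X (f X)) _) => [res [vr lr cr]|]; last first.
  by apply/set0Pn; exists v; rewrite !inE eqxx.
split.
- by move=> /(improve_valid pX)/vr.
- exact: le_trans lr li.
move=> S XS ST hk; have [vS|vS] := boolP (v \in S).
  apply: cr => //; first by rewrite subUset sub1set vS.
  by rewrite cardsU1 vX addnCA add1n -addSn.
apply: le_trans lr _; apply: le_trans li' _; apply: le_trans hv _.
rewrite ler_wpM2l ?exprn_ge0 //.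
by apply: between_le => //; rewrite sub1set inE.
Qed.

End Prim.

(** * Repetition over the guesses *)

Section Amplification.
Variables (R : realType) (V : finType) (r : V) (L : nat).
Hypotheses (card_gt1 : (1 < #|V|)%N) (card_lt_exp : (#|V| < 2 ^ L)%N).
Implicit Types (acc res : best R V) (guesses : seq R).

Fixpoint trials guesses acc : qalg R V (best R V) :=
  if guesses is guess :: gs then qbind (trial r L guess acc) (trials gs) else Ret R V acc.

Lemma num_trials (g : {set V} -> R) guesses acc :
  (num_queries g (trials guesses acc) <= size guesses * trial_cost V L)%N.
Proof.
elim: guesses acc => //= guess gs IH acc; rewrite mulSn.
apply: leq_trans (num_queries_bind (N := size gs * trial_cost V L) _) _.
  exact: always_true.
by rewrite leq_add2r num_trial.
Qed.

(** Thirty trials at least halve the failure probability, and [2 ^ L] exceeds [#|V|], so this number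
    yields [#|V| ^ -c]. *)
Definition repetitions (c : nat) := (30 * (c * L))%N.

(* The value found by [prim] exceeds the minimum cut by a factor at most [2^L]. *)
Definition guesses_of (c : nat) (d : R) : seq R :=
  flatten [seq nseq (repetitions c) (d / 2 ^+ i) | i <- iota 0 L.+1].

Definition mincut_alg (c : nat) : qalg R V (best R V) :=
  Query [set r] (fun d => qbind (prim r L #|V| [set r] ([set r], d)) (fun acc =>
  trials (guesses_of c acc.2) acc)).

Lemma size_guesses c d : size (guesses_of c d) = (L.+1 * repetitions c)%N.
Proof.
rewrite /guesses_of size_flatten /shape -map_comp.
rewrite (eq_map (g := fun=> repetitions c)); last by move=> i /=; rewrite size_nseq.
by elim: L.+1 0%N => //= m IH i; rewrite IH mulSn.
Qed.

Lemma num_mincut_alg (g : {set V} -> R) c :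
  (num_queries g (mincut_alg c) <=
     1 + (#|V| * (2 * L + 1) + L.+1 * repetitions c * trial_cost V L))%N.
Proof.
rewrite add1n ltnS; apply: leq_trans (num_queries_bind
  (N := L.+1 * repetitions c * trial_cost V L) _) _; last by rewrite leq_add2r num_prim.
by apply: always_true => acc; rewrite -(size_guesses c acc.2) num_trials.
Qed.

Variable w : V -> V -> R.
Hypothesis wok : nonneg_symmetric w.
Local Notation f := (wcut w).

Lemma trials_improve guesses acc :
  always f (fun res => (valid f acc -> valid f res) /\ res.2 <= acc.2) (trials guesses acc).
Proof.
elim: guesses acc => //= guess gs IH acc; apply/always_bind.
apply: always_impl (trial_improves r card_gt1 card_lt_exp wok guess acc) => acc' [va la].
by apply: always_impl (IH acc') => res [vr lr]; split; [auto|apply: le_trans lr la].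
Qed.

Variable S0 : {set V}.
Hypotheses (pS0 : proper_cut S0) (minS0 : forall S, proper_cut S -> f S0 <= f S).

(** Each good guess contributes a factor 29/30 whatever [acc] it starts from; a bad guess cannot
    undo a hit. *)
Lemma trials_miss guesses acc (good : pred R) :
  0 < f S0 ->
  (forall guess, good guess -> guess <= f S0 /\ f S0 <= 2 * guess) ->
  expect f (misses w S0) (trials guesses acc) <=
  (29 / 30) ^+ count good guesses * misses w S0 acc.
Proof.
move=> c0 hgood; elim: guesses acc => [|guess gs IH] acc; first by rewrite mul1r.
rewrite /= expect_bind.
have b0 k : 0 <= (29 / 30) ^+ k :> R by rewrite exprn_ge0 // divr_ge0.
apply: le_trans (_ : expect f (fun acc' => (29 / 30) ^+ count good gs * misses w S0 acc')
  (trial r L guess acc) <= _); first by apply/expect_le/always_true.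
rewrite expectZ addnC exprD -mulrA ler_wpM2l //.
rewrite /misses; have [hit|miss] := leP acc.2 (f S0).
  rewrite mulr0; apply: expect_le_cst.
  apply: always_impl (trial_improves r card_gt1 card_lt_exp wok guess acc) => res [_ lr].
  by rewrite ltNge (le_trans lr hit).
rewrite mulr1; have [/hgood[g1 g2]|_] := boolP (good guess); last first.
  by apply/expect_le_cst/always_true => res; rewrite expr0 lern1 leq_b1.
by rewrite expr1; apply: trial_misses.
Qed.

(** For the least [i] with [d / 2 ^+ i <= f S0], the preceding value still exceeds [f S0]. *)
Lemma good_guess (d : R) : 0 < f S0 -> f S0 <= d -> d <= 2 ^+ L * f S0 ->
  exists2 i, (i < L.+1)%N & d / 2 ^+ i <= f S0 /\ f S0 <= 2 * (d / 2 ^+ i).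
Proof.
move=> c0 cd dc.
have ex : exists i, d / 2 ^+ i <= f S0.
  by exists L; rewrite ler_pdivrMr ?exprn_gt0 // mulrC.
case: (ex_minnP ex) => -[|i] hi mini.
  by exists 0%N => //; split=> //; move: hi; rewrite expr0 divr1; lra.
exists i.+1; first by rewrite ltnS; apply: mini; rewrite ler_pdivrMr ?exprn_gt0 // mulrC.
split=> //; have : ~~ (d / 2 ^+ i <= f S0) by apply/negP => /mini; rewrite ltnn.
rewrite -ltNge => /ltW; rewrite exprS.
suff -> : 2 * (d / (2 * 2 ^+ i)) = d / 2 ^+ i by [].
by field; rewrite expf_neq0.
Qed.

Lemma count_guesses c d i (good : pred R) : (i < L.+1)%N -> good (d / 2 ^+ i) ->
  (repetitions c <= count good (guesses_of c d))%N.
Proof.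
move=> iL gi; rewrite /guesses_of count_flatten -map_comp.
have : i \in iota 0 L.+1 by rewrite mem_iota.
elim: (iota 0 L.+1) => //= j s IH; rewrite inE => /orP[/eqP <-|/IH h].
  by rewrite count_nseq gi mul1n leq_addr.
exact: leq_trans h (leq_addl _ _).
Qed.

Lemma pow_29_30_le (c k : nat) : (repetitions c <= k)%N ->
  (29 / 30) ^+ k <= (#|V|%:R ^+ c)^-1 :> R.
Proof.
move=> ck; have V0 : 0 < #|V|%:R :> R by rewrite ltr0n ltnW.
apply: le_trans (_ : (29 / 30) ^+ (repetitions c) <= _).
  by apply: ler_wiXn2l ck; lra.
rewrite /repetitions exprM.
have h30 : (29 / 30) ^+ 30 <= 2^-1 :> R.
  apply: le_trans (_ : expR (- 30^-1) ^+ 30 <= _).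
    rewrite lerXn2r ?nnegrE ?expR_ge0 ?divr_ge0 //.
    by apply: le_trans (expR_ge1Dx _); lra.
  rewrite -expRM_natr mulNr mulVf // expRN lef_pV2 ?posrE ?expR_gt0 //.
  exact: expR_ge1Dx.
apply: le_trans (_ : (2^-1) ^+ (c * L) <= _).
  by rewrite lerXn2r ?nnegrE ?invr_ge0 // exprn_ge0 // divr_ge0.
rewrite exprVn lef_pV2 ?posrE ?exprn_gt0 // mulnC exprM lerXn2r ?nnegrE ?exprn_ge0 ?ler0n //.
by rewrite -natrX ler_nat ltnW.
Qed.

Lemma mincut_alg_valid c : always f (valid f) (mincut_alg c).
Proof.
have p1 := proper_cut1 r card_gt1.
rewrite /mincut_alg /=; apply/always_bind.
have r0 : [set r] != set0 by rewrite -card_gt0 cards1.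
apply: always_impl (prim_spec r card_lt_exp wok #|V| ([set r], f [set r]) r0) => acc [va _ _].
apply: always_impl (trials_improve (guesses_of c acc.2) acc) => res [vr _].
by apply/vr/va.
Qed.

Lemma mincut_alg_misses c : expect f (misses w S0) (mincut_alg c) <= (#|V|%:R ^+ c)^-1.
Proof.
have p1 := proper_cut1 r card_gt1.
have r0 : [set r] != set0 by rewrite -card_gt0 cards1.
rewrite /mincut_alg /= expect_bind; apply: expect_le_cst.
apply: always_impl (prim_spec r card_lt_exp wok #|V| ([set r], f [set r]) r0) => acc [va _ ca].
have {}va : valid f acc by apply: va.
have {}ca : acc.2 <= 2 ^+ L * f S0.
  have hr S : S != setT -> r \in S -> acc.2 <= 2 ^+ L * f S.
    by move=> ST rS; apply: ca; rewrite ?sub1set // cards1 addn1.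
  move: pS0; rewrite proper_cutE => /andP[n0 nT].
  have [rS|rS] := boolP (r \in S0); first exact: hr.
  rewrite -wcutC //; apply: hr; last by rewrite inE.
  by apply: contraNneq n0 => E; rewrite -[S0]setCK E setCT.
(* For a minimum cut of weight 0 the multiplicative guarantee of [prim] is already exact. *)
have [c0|c0] := ltP 0 (f S0); last first.
  apply: le_trans (_ : 0 <= _); last by rewrite invr_ge0 exprn_ge0.
  apply: expect_le_cst; apply: always_impl (trials_improve _ acc) => res [_ lr].
  have f0 : f S0 = 0 by apply/eqP; rewrite eq_le c0 between_ge0.
  by rewrite /misses f0 ltNge (le_trans lr) // (le_trans ca) // f0 mulr0.
pose good guess := (guess <= f S0) && (f S0 <= 2 * guess).
have hgood guess : good guess -> guess <= f S0 /\ f S0 <= 2 * guess by move/andP.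
apply: le_trans (trials_miss _ acc c0 hgood) _.
have [i iL [g1 g2]] : exists2 i, (i < L.+1)%N & acc.2 / 2 ^+ i <= f S0 /\ f S0 <= 2 * (acc.2 / 2 ^+ i).
  by apply: good_guess => //; have [pa ->] := va; apply: minS0.
have gi : good (acc.2 / 2 ^+ i) by rewrite /good g1 g2.
apply: le_trans (pow_29_30_le (count_guesses c iL gi)).
by rewrite ler_piMr ?exprn_ge0 ?divr_ge0 // lern1 leq_b1.
Qed.

End Amplification.

(** * Graphs as symmetric weight functions *)

Section GraphCut.
Variables (R : realType) (V : finType) (G : wgraph R V).

Definition pair_weight (a b : V) : R :=
  if [set a; b] \in edges G then weight G [set a; b] else 0.

Lemma pair_weight_ok : nonneg_symmetric pair_weight.
Proof.
split=> a b; first by rewrite /pair_weight setUC.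
by rewrite /pair_weight; case: ifP => // /weight_ge0.
Qed.

(** An edge cut by [S] corresponds to exactly one ordered pair with first end in [S] and second end
    outside. *)
Lemma cut_pair_weight : cut G = wcut pair_weight.
Proof.
apply: funext => S; rewrite /cut /wcut /between pair_big /=.
pose A := [set p : V * V | [&& p.1 \in S, p.2 \notin S & [set p.1; p.2] \in edges G]].
have inj : {in A &, injective (fun p : V * V => [set p.1; p.2])}.
  move=> [a b] [a' b']; rewrite !inE /= => /and3P[aS bS _] /and3P[a'S b'S _] E.
  have : a \in [set a'; b'] by rewrite -E !inE eqxx.
  have : b \in [set a'; b'] by rewrite -E !inE eqxx orbT.
  rewrite !inE => /orP[/eqP Eb|/eqP ->] /orP[/eqP ->|/eqP Ea] //.
  - by move: bS; rewrite Eb a'S.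
  - by move: bS; rewrite Eb a'S.
  - by move: b'S; rewrite -Ea aS.
transitivity (\sum_(e in [set [set p.1; p.2] | p in A]) weight G e).
  apply: eq_bigl => e; apply/andP/imsetP => [[eE /cards1P[a ea]]|[[a b]]]; last first.
    rewrite inE /= => /and3P[aS bS abE] ->; split=> //.
    rewrite (_ : _ :&: S = [set a]) ?cards1 //; apply/setP => x; rewrite !inE.
    have [->|xa] := eqVneq x a; first by rewrite aS.
    by have [->|//] := eqVneq x b; rewrite (negPf bS).
  have /eqP/cards2P[x [y [xy exy]]] := edges_card2 eE.
  have xa z : z \in e -> z \in S -> z = a by move=> ze zS; apply/set1P; rewrite -ea inE ze.
  have : a \in e :&: S by rewrite ea inE.
  rewrite inE exy !inE => /andP[/orP[/eqP ax|/eqP ay] aS].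
    exists (x, y); rewrite // inE /= -exy eE -ax aS andbT /=.
    by apply/negP => yS; move: xy; rewrite -ax -(xa y) ?eqxx // exy !inE eqxx orbT.
  exists (y, x); last by rewrite /= setUC.
  rewrite inE /= setUC -exy eE -ay aS andbT /=.
  by apply/negP => xS; move: xy; rewrite -ay (xa x) ?eqxx // exy !inE eqxx.
rewrite (big_imset _ inj) /= [RHS]big_mkcond [LHS]big_mkcond; apply: eq_bigr => -[a b] _.
by rewrite !inE /pair_weight /=; case: (a \in S); case: (b \in S).
Qed.

End GraphCut.

(** The [L ^ 4] comes from the search: a plan of order [n * L ^ 3] times a depth linear in [L]. *)
Lemma trial_cost_le : exists K, forall n L, (0 < L)%N ->
  (trial_cost 'I_n L <= K * (n * L ^ 4))%N.
Proof.
pose k := (17 ^ 2 * 36)%N; exists (4 + 3200 * k + 1800)%N => n L L0.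
rewrite /trial_cost /sample_size /plan_size /search_depth card_ord -/k.
move: k => k; have [L1 L2] : (L <= L ^ 4 /\ L * L <= L ^ 4)%N.
  by rewrite mulnn -[X in (X <= _)%N /\ _]expn1 !leq_pexp2l.
have L4 : (L * L ^ 3 = L ^ 4)%N by rewrite [RHS]expnS.
move: (L ^ 4)%N (L ^ 3)%N => x4 x3 in L1 L2 L4 *.
have hA : (n + n * (2 * L + 1) <= n * (4 * x4))%N.
  by rewrite -mulnS leq_mul2l; apply/orP; right; lia.
have hC : (k * n * ((7 + L) * (2 * L)) <= k * n * (16 * x4))%N.
  by rewrite leq_mul2l; apply/orP; right; nia.
have hD : (n * ((8 + 4 * L) * x3) <= n * (12 * x4))%N.
  by rewrite leq_mul2l; apply/orP; right; nia.
nia.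
Qed.

(** As [ln 2 >= 1/2], both the logarithm to base 2 and the added 1 are at most [2 * ln n]. *)
Lemma log_le_ln (R : realType) n : (1 < n)%N ->
  (trunc_log 2 n).+1%:R <= 4 * ln (n%:R : R).
Proof.
move=> n1; have n0 : 0 < n%:R :> R by rewrite ltr0n ltnW.
have ln2 : 2^-1 <= ln 2 :> R.
  rewrite -ler_expR lnK ?posrE // -[2^-1]opprK expRN invf_ple ?posrE ?expR_gt0 //.
  by apply: le_trans (expR_ge1Dx _); lra.
have h1 : (trunc_log 2 n)%:R * ln 2 <= ln n%:R :> R.
  rewrite mulr_natl -lnXn // ler_ln ?posrE ?exprn_gt0 // -natrX ler_nat.
  by apply: trunc_logP; rewrite // ltnW.
have h2 : ln 2 <= ln n%:R :> R by rewrite ler_ln ?posrE // ler_nat.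
have h3 : (trunc_log 2 n)%:R * 2^-1 <= (trunc_log 2 n)%:R * ln 2 :> R by rewrite ler_wpM2l.
by rewrite mulrS; lra.
Qed.

Theorem theorem1p2 (R : realType) :
  exists (alg : forall c n : nat, qalg R 'I_n ({set 'I_n} * R)) (k : nat),
  forall c : nat, exists C : R,
  forall (n : nat) (G : wgraph R 'I_n), (2 <= n)%N ->
    (num_queries (cut G) (alg c n))%:R <= C * n%:R * ln (n%:R : R) ^+ k /\
    1 - (n%:R ^+ c)^-1 <= prob_out (cut G) (correct_output G) (alg c n).
Proof.
pose alg (c n : nat) : qalg R 'I_n ({set 'I_n} * R) :=
  if n is m.+1 return qalg R 'I_n ({set 'I_n} * R)
  then mincut_alg R ord0 (trunc_log 2 m.+1).+1 c else Ret R 'I_0 (set0, 0).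
have [K hK] := trial_cost_le.
(* A trial costs [K * (n * L ^ 4)]; at most [2 * L] guesses times [30 * (c * L)] repetitions give
   [60 * c] and two more powers of [L]. The [4 ^ 6] pays for replacing [L] by [4 * ln n]. *)
exists alg, 6%N => c; exists (((4 + 60 * c * K) * 4 ^ 6)%N%:R) => -[//|m] G n1.
set n := m.+1 in G n1 *; set L := (trunc_log 2 n).+1.
have algE : alg c n = mincut_alg R ord0 L c by [].
have V1 : (1 < #|'I_n|)%N by rewrite card_ord.
have VL : (#|'I_n| < 2 ^ L)%N by rewrite card_ord trunc_log_ltn.
split.
  have le1 : (num_queries (cut G) (alg c n) <= (4 + 60 * c * K) * (n * L ^ 6))%N.
    rewrite algE; apply: leq_trans (num_mincut_alg _ _ _ _ _) _ => //.
    have hc := hK n L isT; have n0 : (0 < n)%N by [].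
    rewrite card_ord /repetitions.
    have [L1 L2] : (1 <= L ^ 6 /\ L <= L ^ 6)%N.
      by rewrite expn_gt0 /= -[leqLHS]expn1 leq_pexp2l.
    apply: leq_trans (_ : 4 * (n * L ^ 6) + (2 * L) * (30 * (c * L)) * (K * (n * L ^ 4)) <= _)%N.
      rewrite addnA leq_add //; first by nia.
      by apply: leq_mul => //; apply: leq_mul => //; lia.
    rewrite mulnDl leq_add2l leq_eqVlt; apply/orP; left; apply/eqP.
    by rewrite !expnS expn0; ring.
  have := log_le_ln R n1; rewrite -/L => hL.
  apply: le_trans (_ : ((4 + 60 * c * K) * (n * L ^ 6))%N%:R <= _); first by rewrite ler_nat.
  have hL6 : L%:R ^+ 6 <= (4 * ln n%:R) ^+ 6 :> R by rewrite lerXn2r ?nnegrE ?(le_trans _ hL).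
  set A := (4 + 60 * c * K)%N; rewrite [leLHS]natrM [(n * _)%:R]natrM natrX [(A * 4 ^ 6)%:R]natrM natrX.
  have -> : A%:R * 4 ^+ 6 * n%:R * ln n%:R ^+ 6 = A%:R * (n%:R * (4 * ln n%:R) ^+ 6) :> R by ring.
  by do 2!apply: ler_wpM2l => //.
have wok := pair_weight_ok G; rewrite cut_pair_weight algE.
have p1 := proper_cut1 (ord0 : 'I_n) V1.
case: (@arg_minP _ _ _ [set ord0 : 'I_n] (@proper_cut 'I_n) (cut G) p1) => S0 pS0.
rewrite cut_pair_weight => minS0.
have miss := mincut_alg_misses ord0 V1 VL wok pS0 minS0 c; rewrite card_ord in miss.
rewrite prob_outE; set a := mincut_alg _ _ _ _ in miss *; set f := wcut _ in miss minS0 *.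
apply: le_trans (_ : 1 - expect f (misses (pair_weight G) S0) a <= _); first by rewrite lerD2l lerN2.
rewrite -mulN1r -expectZ -[X in X + _](expect_cst f 1 a) -expectD.
apply: expect_le; apply: always_impl (mincut_alg_valid ord0 V1 VL wok c) => res [pr er].
rewrite /correct_output /misses /is_mincut pr er cut_pair_weight eqxx andbT /= -/f.
case: ltP => [_|le]; first by rewrite mulr1 subrr.
rewrite mulr0 addr0; suff -> : [forall T, proper_cut T ==> (f res.1 <= f T)] by [].
by apply/forallP => T; apply/implyP => pT; apply: le_trans le (minS0 _ pT).
Qed.
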